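(* Let $E$ be an interval effect algebra whose state space $\mathcal S(E)$ is a Bauer simplex, and let $s$ be a state on $E$. Then there is a unique regular Borel probability measure $\mu_s$ on $\mathcal B(\mathcal S(E))$ such that $$s(a)=\int_{\partial_e\mathcal S(E)}\hat a(x)\, d\mu_s(x),\qquad a\in E,$$ where $\hat a(x):=x(a)$ for $x\in\mathcal S(E)$ and $\partial_e\mathcal S(E)$ is the set of extreme points of $\mathcal S(E)$.
   Context: An effect algebra is a partial algebra $(E;+,0,1)$ with a partially defined binary operation $+$ and constants $0,1$ such that for all $a,b,c\in E$: (i) $a+b$ is defined iff $b+a$ is defined, and then $a+b=b+a$; (ii) $a+b$ and $(a+b)+c$ are defined iff $b+c$ and $a+(b+c)$ are defined, and then $(a+b)+c=a+(b+c)$; (iii) for each $a\in E$ there is a unique $a'\in E$ with $a+a'=1$; (iv) if $a+1$ is defined then $a=0$. It is assumed throughout that $0\neq 1$. For an Abelian partially ordered group $G$ and $u\in G$, $u\ge 0$, put $\Gamma(G,u):=\{g\in G: 0\le g\le u\}$; with the restriction of the group addition (defined when the sum is still in $\Gamma(G,u)$) and with constants $0,u$ it is an effect algebra. An interval effect algebra is an effect algebra isomorphic to some $\Gamma(G,u)$. (A homomorphism of effect algebras preserves all existing sums and $1$; an isomorphism is a bijective homomorphism whose inverse is a homomorphism.) A state on $E$ is a mapping $s:E\to[0,1]$ with $s(1)=1$ and $s(a+b)=s(a)+s(b)$ whenever $a+b$ is defined. $\mathcal S(E)$ is the set of all states on $E$, a convex set, endowed with the topology of pointwise convergence on $E$ (a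 compact convex Hausdorff space, sitting in the locally convex space $\mathbb R^E$). Simplex: a convex cone in a real linear space $V$ is a subset $C$ containing $0$ and closed under linear combinations with nonnegative real coefficients; it is strict if $C\cap -C=\{0\}$; a strict cone defines a partial order $x\le_C y$ iff $y-x\in C$; a lattice cone is a strict convex cone $C$ that is a lattice under $\le_C$. A base for $C$ is a convex subset $K\subseteq C$ such that every nonzero $y\in C$ is uniquely of the form $y=\alpha x$ with $\alpha\in\mathbb R^+$, $x\in K$. A simplex is a convex subset of a linear space that is affinely isomorphic to a base for a lattice cone in some real linear space. A simplex $K$ in a locally convex Hausdorff space is a Bauer simplex if $K$ and its set of extreme points $\partial_e K$ are both compact. (The hypothesis that $\mathcal S(E)$ is a Bauer simplex is called the Bauer state property (BSP).) A Borel measure $\mu$ on a compact Hausdorff space $K$ is regular if for every Borel set $Y$, $\mu(Y)=\inf\{\mu(O): Y\subseteq O,\ O \text{ open}\}=\sup\{\mu(C): C\subseteq Y,\ C\text{ closed}\}$. *)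

(* Defs.v *)
From HB Require Import structures.
From mathcomp Require Import all_boot all_order all_algebra.
From mathcomp Require Import all_classical all_reals all_analysis.

Set Implicit Arguments.
Unset Strict Implicit.
Unset Printing Implicit Defensive.

Import Order.TTheory GRing.Theory Num.Theory.
Import numFieldNormedType.Exports.

Local Open Scope classical_set_scope.
Local Open Scope ring_scope.

(* [padd a b = None] encodes that the sum of [a] and [b] is undefined. *)
HB.mixin Record isPartialAlgebra T := {
  pzero : T;
  pone : T;
  padd : T -> T -> option T
}.

#[short(type="partialAlgebraType")]
HB.structure Definition PartialAlgebra := {T of isPartialAlgebra T}.

HB.mixin Record PartialAlgebra_isEffectAlgebra T & PartialAlgebra T := {
  paddC : forall a b : T, padd a b = padd b a;
  (* both sides are [None] unless both sums occurring in them are defined *)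
  paddA : forall a b c : T,
    obind (fun ab => padd ab c) (padd a b) =
    obind (fun bc => padd a bc) (padd b c);
  orthosupplement : forall a : T, exists! a' : T, padd a a' = Some pone;
  padd_pone : forall a : T, padd a pone <> None -> a = pzero;
  pzero_neq_pone : (pzero : T) <> pone
}.

#[short(type="effectAlgebraType")]
HB.structure Definition EffectAlgebra :=
  {T of PartialAlgebra T & PartialAlgebra_isEffectAlgebra T}.

Definition pa_morphism (A B : partialAlgebraType) (f : A -> B) : Prop :=
  f pone = pone /\
  forall a b c : A, padd a b = Some c -> padd (f a) (f b) = Some (f c).

Definition pa_isomorphic (A B : partialAlgebraType) : Prop :=
  exists (f : A -> B) (g : B -> A),
    [/\ cancel f g, cancel g f, pa_morphism f & pa_morphism g].

(* The structure [porderZmodType] has no axiom linking the order and the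
   addition. *)
Definition translation_invariant (G : porderZmodType) : Prop :=
  forall x y z : G, x <= y -> x + z <= y + z.

Definition Gamma (G : porderZmodType) (u : G) (u_ge0 : 0 <= u) : Type :=
  {g : G | 0 <= g <= u}.

Section GammaAlgebra.
Variables (G : porderZmodType) (u : G) (u_ge0 : 0 <= u).

Let zero_in : 0 <= (0 : G) <= u. Proof. by rewrite lexx u_ge0. Qed.
Let unit_in : 0 <= u <= u. Proof. by rewrite lexx u_ge0. Qed.

HB.instance Definition _ := isPartialAlgebra.Build (Gamma u_ge0)
  (exist _ 0 zero_in : Gamma u_ge0)
  (exist _ u unit_in : Gamma u_ge0)
  (fun g h => insub (val g + val h) : option {g : G | 0 <= g <= u}).

End GammaAlgebra.

Definition interval_effect_algebra (E : effectAlgebraType) : Prop :=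
  exists (G : porderZmodType) (u : G) (u_ge0 : 0 <= u),
    translation_invariant G /\ pa_isomorphic E (Gamma u_ge0).

Section Cones.
Variables (R : realType) (V : lmodType R).
Implicit Types C K : set V.

Definition convex_cone C : Prop :=
  C 0 /\ forall (a b : R) (x y : V), 0 <= a -> 0 <= b -> C x -> C y ->
    C (a *: x + b *: y).

Definition strict_cone C : Prop :=
  convex_cone C /\ C `&` [set - x | x in C] = [set 0].

Definition cone_le C (x y : V) : Prop := C (y - x).

(* Suprema and infima are taken inside the cone, not in the whole space. *)
Definition lattice_cone C : Prop :=
  strict_cone C /\
  forall x y, C x -> C y ->
    (exists2 z, C z & [/\ cone_le C x z, cone_le C y z &
       forall w, C w -> cone_le C x w -> cone_le C y w -> cone_le C z w]) /\
    (exists2 z, C z & [/\ cone_le C z x, cone_le C z y &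
       forall w, C w -> cone_le C w x -> cone_le C w y -> cone_le C w z]).

Definition cone_base C K : Prop :=
  [/\ convex_set K, K `<=` C &
      forall y, C y -> y <> 0 ->
        exists! p : R * V, [/\ 0 <= p.1, K p.2 & y = p.1 *: p.2]].

Definition extreme_points K : set V :=
  [set x | K x /\ forall (t : R) (y z : V), K y -> K z -> 0 < t < 1 ->
     x = t *: y + (1 - t) *: z -> y = x /\ z = x].

End Cones.

Definition affine_on (R : realType) (U V : lmodType R) (K : set U)
    (f : U -> V) : Prop :=
  forall (t : R) (x y : U), 0 <= t <= 1 -> K x -> K y ->
    f (t *: x + (1 - t) *: y) = t *: f x + (1 - t) *: f y.

Definition affine_isomorphic (R : realType) (U V : lmodType R)
    (K : set U) (L : set V) : Prop :=
  exists f : U -> V, set_bij K L f /\ affine_on K f.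

Definition simplex (R : realType) (U : lmodType R) (K : set U) : Prop :=
  convex_set K /\
  exists (V : lmodType R) (C L : set V),
    [/\ lattice_cone C, cone_base C L & affine_isomorphic K L].

(* A [tvsType] is locally convex but need not be Hausdorff; [ptws_space] below
   is, by [ptws_space_hausdorff]. *)
Definition Bauer_simplex (R : realType) (U : tvsType R) (K : set U) : Prop :=
  [/\ simplex K, compact K & compact (extreme_points K)].

Definition ptws_space (E : Type) (R : realType) : Type := {ptws E -> R^o}.

HB.instance Definition _ (E : Type) (R : realType) :=
  Topological.copy (ptws_space E R) {ptws E -> R^o}.
HB.instance Definition _ (E : Type) (R : realType) :=
  GRing.Lmodule.copy (ptws_space E R) (E -> R^o).

Section PtwsSpace.
Variables (E : Type) (R : realType).
Local Notation X := (ptws_space E R).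

Lemma ptws_space_cvgP (F : set_system X) (f : X) : Filter F ->
  (F --> f) <-> (forall t, (fun g : X => g t) @ F --> f t).
Proof.
move=> FF; split.
  move=> /cvg_sup Ff t U ft_U; apply: (Ff t).
  have [V [oV Vft VU]] : exists V, [/\ open V, V (f t) & V `<=` U].
    by move: ft_U; rewrite nbhsE => -[V [oV Vft] VU]; exists V.
  rewrite nbhsE; exists ((fun g : X => g t) @^-1` V) => /=; last first.
    by move=> g /VU.
  by split => //; exists V.
move=> Ff; apply/cvg_sup => t U; rewrite nbhsE => -[_ [[V oV <-] Vft] VU].
apply: filterS VU _; apply: (Ff t); rewrite nbhsE; exists V => //.
Qed.

Lemma ptws_space_eval_continuous (t : E) : continuous (fun g : X => g t).
Proof.
by move=> f; have /ptws_space_cvgP : nbhs f --> f by []; exact.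
Qed.

Lemma ptws_space_hausdorff : hausdorff_space X.
Proof.
move=> p q pq; apply/funext => t; apply: (@Rhausdorff R) => A B pA qB.
have [g [Ag Bg]] := pq _ _ (ptws_space_eval_continuous pA)
                           (ptws_space_eval_continuous qB).
by exists (g t).
Qed.

Lemma ptws_space_continuous (T : topologicalType) (f : T -> X) :
  (forall t, continuous (fun x => f x t : R^o)) -> continuous f.
Proof.
move=> cf x; have FF : Filter (f @ x) by exact: fmap_filter.
by apply/(ptws_space_cvgP _ FF) => t; exact: cf.
Qed.

Let add_continuous : continuous (fun x : X * X => x.1 + x.2).
Proof.
apply: (@ptws_space_continuous (X * X)%type) => t x.
have c1 : (fun y : X * X => y.1 t) @ x --> x.1 t.
  exact: (@cvg_comp _ _ _ fst (fun g : X => g t) _ _ _ cvg_fst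
    (@ptws_space_eval_continuous t x.1)).
have c2 : (fun y : X * X => y.2 t) @ x --> x.2 t.
  exact: (@cvg_comp _ _ _ snd (fun g : X => g t) _ _ _ cvg_snd
    (@ptws_space_eval_continuous t x.2)).
exact: (@cvgD _ R^o _ _ (nbhs_filter x) _ _ _ _ c1 c2).
Qed.

Let scale_continuous : continuous (fun z : R^o * X => z.1 *: z.2).
Proof.
apply: (@ptws_space_continuous (R^o * X)%type) => t x.
have c1 : (fun y : R^o * X => y.1) @ x --> x.1 by exact: cvg_fst.
have c2 : (fun y : R^o * X => y.2 t) @ x --> x.2 t.
  exact: (@cvg_comp _ _ _ snd (fun g : X => g t) _ _ _ cvg_snd
    (@ptws_space_eval_continuous t x.2)).
exact: (@cvgM _ _ _ (nbhs_filter x) _ _ _ _ c1 c2).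
Qed.

Let ptws_locally_convex :
  exists2 B : set_system X, (forall b, b \in B -> convex_set b) & basis B.
Proof.
exists [set b : set X | open b /\ convex_set b].
  by move=> b /set_mem[].
split=> [b []//|f].
set F := filter_from _ _.
have FF : Filter F.
  apply: filter_from_filter.
    by exists setT; do ![split]; [exact: openT | move=> *; rewrite inE].
  move=> A B [[oA cA] Af] [[oB cB] Bf]; exists (A `&` B) => //.
  do 2?split => //; first exact: openI.
  move=> x y l /set_mem[Ax Bx] /set_mem[Ay By]; apply/mem_set; split.
  - by apply/set_mem/cA; exact/mem_set.
  - by apply/set_mem/cB; exact/mem_set.
have [B Bconvex [Bopen Bbasis]] := @locally_convex R R^o.
apply/ptws_space_cvgP => t U ftU.
have [b [Bb bft] bU] := Bbasis _ _ ftU.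
exists ((fun g : X => g t) @^-1` b); last by move=> g /bU.
do 2?split => //.
  apply: open_comp; last exact: Bopen.
  by move=> g _; exact: ptws_space_eval_continuous.
move=> x y l /set_mem /= bx /set_mem /= hy; apply/mem_set => /=.
exact/set_mem/(Bconvex b (mem_set Bb) (x t) (y t) l (mem_set bx) (mem_set hy)).
Qed.

HB.instance Definition _ := @PreTopologicalLmod_isTvs.Build R (ptws_space E R)
  add_continuous scale_continuous ptws_locally_convex.
HB.instance Definition _ :=
  PreTopologicalNmodule_isTopologicalNmodule.Build (ptws_space E R)
    add_continuous.
HB.instance Definition _ :=
  TopologicalNmodule_isTopologicalLmodule.Build R (ptws_space E R)
    scale_continuous.
HB.instance Definition _ :=
  Uniform_isTvs.Build R (ptws_space E R) ptws_locally_convex.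

End PtwsSpace.

Definition states (E : effectAlgebraType) (R : realType) :
    set (ptws_space E R) :=
  [set s | [/\ forall a, 0 <= s a <= 1, s pone = 1 &
     forall a b c, padd a b = Some c -> s c = s a + s b]].
Arguments states : clear implicits.

Section States.
Variables (E : effectAlgebraType) (R : realType).

(* Measurable types of the library are pointed: a given state [s] serves as the
   distinguished point and plays no other role. *)
Definition state_space (s : states E R) : Type := states E R.

HB.instance Definition _ (s : states E R) := Topological.on (state_space s).
HB.instance Definition _ (s : states E R) := isPointed.Build (state_space s) s.

Definition extreme_states (s : states E R) : set (state_space s) :=
  [set x | extreme_points (states E R) (\val x)].

End States.
Arguments extreme_states {E R} s.

Definition evaluation (E : effectAlgebraType) (R : realType) (a : E)
    (x : states E R) : R := \val x a.

Definition borel_display (T : ptopologicalType) : measure_display :=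
  sigma_display (@open T).

Definition borel (T : ptopologicalType) : measurableType (borel_display T) :=
  g_sigma_algebraType (@open T).

Definition regular_measure (R : realType) (T : ptopologicalType)
    (mu : set (borel T) -> \bar R) : Prop :=
  forall Y : set (borel T), measurable Y ->
    mu Y = ereal_inf [set mu O | O in [set O : set T | open O /\ Y `<=` O]] /\
    mu Y = ereal_sup [set mu C | C in [set C : set T | closed C /\ C `<=` Y]].

Definition represents (R : realType) (E : effectAlgebraType) (s : states E R)
    (mu : probability (borel (state_space s)) R) : Prop :=
  forall a : E,
    (evaluation a s)%:E =
    (\int[mu]_(x in extreme_states s) (evaluation a x)%:E)%E.

(* Main.v *)
Require Import Defs.
From HB Require Import structures.
From mathcomp Require Import all_boot all_order all_algebra.
From mathcomp Require Import all_classical all_reals all_analysis.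
From mathcomp Require Import lra.

Set Implicit Arguments.
Unset Strict Implicit.
Unset Printing Implicit Defensive.

Import Order.TTheory GRing.Theory Num.Theory.
Import numFieldNormedType.Exports.

Local Open Scope classical_set_scope.
Local Open Scope ring_scope.

(* Uniqueness.  By Riesz decomposition in the cone of positive additive functions
   on E, the Riesz-Kantorovich formula gives the supremum F of finitely many
   functionals p |-> sum c_i p(a_i) as an additive functional on that cone.
   Compactness makes F upper semicontinuous, and at an extreme state F is just
   the maximum f of the functionals.  Cutting the extreme states into small
   pieces and replacing each piece by its barycenter, which is a state for
   trivial reasons, one gets int f dmu = F(s) for every mu representing s.
   Differences of such maxima f form a vector lattice separating the states,
   hence separate disjoint closed sets, and regularity concludes.

   Existence.  By Bauer's principle a functional sum c_i a_i^ is at s at least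
   its minimum over the extreme states.  Hahn-Banach then yields a positive
   functional on bounded functions, that is, a finitely additive probability m
   on all subsets, which represents s.  The regular Borel measure built from
   the inner content sup {m(C) : C closed in O} of open sets O dominates m on
   closed sets, so by a layer-cake estimate its barycenter dominates s, and
   both being states they agree. *)

(** * Compactness and the Hahn-Banach theorem *)

(** If [P C] failed, the sets whose complement in [C] satisfies [P] would form a proper filter
    containing [C]. At a cluster point of it, the small neighbourhood [N] satisfies [P], so its
    complement lies in the filter, a contradiction. *)
Lemma compact_ind (T : topologicalType) (C : set T) (P : set T -> Prop) :
  compact C -> P set0 -> (forall A B, P A -> P B -> P (A `|` B)) ->
  (forall A B, A `<=` B -> P B -> P A) ->
  (forall x, C x -> exists2 N, nbhs x N & P N) -> P C.
Proof.
move=> cC P0 PU Psub Ploc; apply: contrapT => nPC.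
pose F : set_system T := [set A | P (C `\` A)].
have FF : ProperFilter F.
  split; first by rewrite /F /= setD0.
  split=> [|A B|A B AB]; rewrite /F /=.
  - by rewrite setDT.
  - by rewrite setDIr; exact: PU.
  - by apply: Psub; exact: setDS.
have FC : F C by rewrite /F /= setDv.
have [x [Cx clx]] := cC F FF FC.
have [N Nx PN] := Ploc x Cx.
have FN : F (~` N) by rewrite /F /= setDE setCK; apply: Psub PN => y [].
by have [y [nNy Ny]] := clx _ _ FN Nx.
Qed.

Section HahnBanach.
Variables (R : realType) (V : lmodType R).

Definition sublinear (q : V -> R) : Prop :=
  (forall x y, q (x + y) <= q x + q y) /\
  (forall t x, 0 <= t -> q (t *: x) = t * q x).

Lemma sublinear0 q : sublinear q -> q 0 = 0.
Proof. by move=> [_ qZ]; rewrite -(scale0r 0) qZ// mul0r. Qed.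

Lemma sublinearN q x : sublinear q -> - q (- x) <= q x.
Proof.
move=> sq; have := sq.1 x (- x); rewrite subrr (sublinear0 sq).
by move=> ?; lra.
Qed.

(** Near-minimizers at [x] and at [y] may differ, but in a chain the smaller of the two is good at
    both points, which gives subadditivity. The minorant [q0] keeps the infima finite. *)
Lemma sublinear_inf (I : Type) (A : set I) (q : I -> V -> R) (q0 : V -> R) :
  A !=set0 -> (forall i, A i -> sublinear (q i)) ->
  (forall i x, A i -> q0 x <= q i x) ->
  (forall i j, A i -> A j -> (forall x, q i x <= q j x) \/
                             (forall x, q j x <= q i x)) ->
  sublinear (fun x => inf [set q i x | i in A]).
Proof.
move=> [i0 Ai0] sq q0q tot.
have hi x : has_inf [set q i x | i in A].
  split; first by exists (q i0 x), i0.
  by exists (q0 x) => _ [i Ai <-]; exact: q0q.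
split=> [x y|t x].
  apply/ler_addgt0Pr => e e0.
  have e2 : 0 < e / 2 by rewrite divr_gt0.
  have [_ [i Ai <-] ile] := inf_adherent e2 (hi x).
  have [_ [j Aj <-] jle] := inf_adherent e2 (hi y).
  have [k [Ak kx ky]] : exists k, [/\ A k, q k x <= q i x & q k y <= q j y].
    by have [ij|ji] := tot _ _ Ai Aj; [exists i|exists j].
  have h : inf [set q i (x + y) | i in A] <= q k (x + y).
    by apply: ge_inf; [exact: (hi _).2|exists k].
  have := (sq k Ak).1 x y; lra.
rewrite le_eqVlt => /predU1P[<-|t0].
  rewrite mul0r (_ : [set _ | _ in _] = [set 0]) ?inf1//.
  apply/seteqP; split=> [_ [i Ai <-]|_ ->].
    by rewrite (sq i Ai).2// mul0r.
  by exists i0 => //; rewrite (sq i0 Ai0).2// mul0r.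
apply/eqP; rewrite eq_le; apply/andP; split.
  rewrite mulrC -ler_pdivrMr//; apply: lb_le_inf => [|_ [i Ai <-]].
    by exists (q i0 x), i0.
  rewrite ler_pdivrMr// mulrC -(sq i Ai).2 ?(ltW t0)//.
  by apply: ge_inf; [exact: (hi _).2|exists i].
apply: lb_le_inf => [|_ [i Ai <-]]; first by exists (q i0 (t *: x)), i0.
rewrite (sq i Ai).2 ?(ltW t0)// ler_pM2l//.
by apply: ge_inf; [exact: (hi _).2|exists i].
Qed.

Lemma minimal_sublinear_additive (q : V -> R) : sublinear q ->
  (forall q', sublinear q' -> (forall x, q' x <= q x) ->
     forall x, q x <= q' x) ->
  forall x y, q (x + y) = q x + q y.
Proof.
move=> sq qmin x h; apply/eqP; rewrite eq_le sq.1/=.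
(* [fun y => inf (S y)] is a sublinear minorant of [q]; minimality makes it
   equal to [q], and the choice [t = 1] then gives superadditivity. *)
pose S x := [set q (x + t *: h) - t * q h | t in [set t | 0 <= t]].
have S0 y : S y !=set0 by exists (q (y + 0 *: h) - 0 * q h), 0 => /=.
have Slb y : has_lbound (S y).
  exists (- q (- y)) => _ [t /= t0 <-].
  by have := sq.1 (y + t *: h) (- y); rewrite addrAC subrr add0r sq.2//; lra.
have q'q y : inf (S y) <= q y.
  by apply: ge_inf => //; exists 0; rewrite /= ?scale0r ?mul0r ?addr0 ?subr0.
have sq' : sublinear (fun y => inf (S y)).
  split=> [y z|t y].
    apply/ler_addgt0Pr => e e0.
    have e2 : 0 < e / 2 by rewrite divr_gt0.
    have [_ [t /= t0 <-] tle] := inf_adherent e2 (conj (S0 y) (Slb y)).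
    have [_ [u /= u0 <-] ule] := inf_adherent e2 (conj (S0 z) (Slb z)).
    have : inf (S (y + z)) <= q (y + z + (t + u) *: h) - (t + u) * q h.
      by apply: ge_inf => //; exists (t + u) => //=; exact: addr_ge0.
    have := sq.1 (y + t *: h) (z + u *: h).
    by rewrite addrACA -scalerDl; lra.
  rewrite le_eqVlt => /predU1P[<-|t0].
    rewrite mul0r (_ : S _ = [set 0]) ?inf1//.
    apply/seteqP; split=> [_ [u /= u0 <-]|_ ->].
      by rewrite scale0r add0r sq.2// subrr.
    by exists 0; rewrite /= ?scale0r ?addr0 ?(sublinear0 sq) ?mul0r ?subrr.
  apply/eqP; rewrite eq_le; apply/andP; split.
    rewrite mulrC -ler_pdivrMr//; apply: lb_le_inf => // _ [u /= u0 <-].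
    rewrite ler_pdivrMr// mulrC mulrBr -(sq.2 t (y + _)) ?(ltW t0)// scalerDr
      scalerA mulrA.
    by apply: ge_inf => //; exists (t * u) => //=; rewrite mulr_ge0// ltW.
  apply: lb_le_inf => // _ [u /= u0 <-].
  have tu : t * (u / t) = u by rewrite mulrC divfK// gt_eqF.
  have -> : q (t *: y + u *: h) - u * q h =
            t * (q (y + (u / t) *: h) - (u / t) * q h).
    rewrite mulrBr -(sq.2 t (y + _)) ?(ltW t0)// scalerDr scalerA.
    by rewrite tu mulrA tu.
  rewrite ler_pM2l//; apply: ge_inf => //.
  by exists (u / t) => //=; rewrite divr_ge0// ltW.
have /le_trans : q x <= q (x + h) - q h.
  apply: le_trans (qmin _ sq' q'q x) _; apply: ge_inf => //.
  by exists 1; rewrite /= ?ler01// scale1r mul1r.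
by move=> /(_ _ (lexx _)) ?; lra.
Qed.

(** Zorn's lemma gives a minimal sublinear function below [q0], and minimality makes it additive. *)
Lemma hahn_banach (q0 : V -> R) : sublinear q0 ->
  exists f : V -> R, [/\ forall x y, f (x + y) = f x + f y,
    forall t x, 0 <= t -> f (t *: x) = t * f x & forall x, f x <= q0 x].
Proof.
move=> sq0.
pose P (q : V -> R) := sublinear q /\ forall x, q x <= q0 x.
pose D := {q | P q}.
(* [ZL_preorder] produces maximal elements, so the pointwise order is reversed. *)
pose r (p q : D) := `[< forall x, sval q x <= sval p x >].
have d0 : D by exists q0.
have [| | |q qmin] := @ZL_preorder D d0 r.
- by move=> q; apply/asboolP.
- move=> q p s /asboolP qp /asboolP ps; apply/asboolP => x.
  exact: le_trans (ps x) (qp x).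
- move=> A tot; have [A0|/set0P/negP/negPn/eqP ->] := pselect (A !=set0).
    have sq : sublinear (fun x => inf [set sval q x | q in A]).
      apply: (@sublinear_inf D A (fun q => sval q) (fun x => - q0 (- x))) => //.
      - by move=> q _; exact: (svalP q).1.
      - move=> q x _; have [sq qq0] := svalP q.
        apply: le_trans (sublinearN _ sq); rewrite lerN2; exact: qq0.
      - by move=> p q Ap Aq; have [/asboolP|/asboolP] := tot _ _ Ap Aq;
          [right|left].
    have lb q x : A q -> inf [set sval q x | q in A] <= sval q x.
      move=> Aq; apply: ge_inf; last by exists q.
      exists (- q0 (- x)) => _ [p Ap <-]; have [sp pq0] := svalP p.
      by apply: le_trans (sublinearN _ sp); rewrite lerN2; exact: pq0.
    have le0 x : inf [set sval q x | q in A] <= q0 x.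
      case: A0 => q Aq; apply: le_trans (lb _ _ Aq) _.
      exact: (svalP q).2.
    by exists (exist P _ (conj sq le0)) => q Aq; apply/asboolP => x; exact: lb.
  by exists d0.
have [sq qq0] := svalP q; exists (sval q); split=> //; last exact: sq.2.
apply: minimal_sublinear_additive => // q' sq' q'q.
have q'q0 x : q' x <= q0 x by exact: le_trans (q'q x) (qq0 x).
have /qmin/asboolP : r q (exist P q' (conj sq' q'q0)) by apply/asboolP.
exact.
Qed.

End HahnBanach.

(** * Regular Borel measures from finitely additive probabilities *)

Definition finitely_additive_probability (R : realType) (T : Type)
    (m : set T -> R) : Prop :=
  [/\ forall A, 0 <= m A,
      forall A B, A `&` B = set0 -> m (A `|` B) = m A + m B &
      m setT = 1].

Section RegularMeasure.
Local Open Scope ereal_scope.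
Variables (R : realType) (T : ptopologicalType) (m : set T -> R).
Hypotheses (hausT : hausdorff_space T) (cptT : compact [set: T]).
Hypothesis (m_prob : finitely_additive_probability m).

Let m_ge0 A : (0 <= m A)%R. Proof. by case: m_prob. Qed.

Let m0 : m set0 = 0%R.
Proof.
have [_ mU _] := m_prob; have := mU set0 set0 (set0I _).
by rewrite setU0 => ?; lra.
Qed.

Let m_le A B : A `<=` B -> (m A <= m B)%R.
Proof.
move=> AB; have [_ mU _] := m_prob.
rewrite -(setDUK AB) mU; last by rewrite setDE setIC -setIA setICl setI0.
by rewrite lerDl.
Qed.

Let m_leU A B : (m (A `|` B) <= m A + m B)%R.
Proof.
have [_ mU _] := m_prob.
have -> : A `|` B = A `|` (B `\` A) by rewrite setDE setUIr setUCr setIT.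
rewrite mU; last by rewrite setDE setIC -setIA setICl setI0.
by rewrite lerD2l; apply: m_le => x [].
Qed.

Let m_le1 A : (m A <= 1)%R.
Proof. by case: (m_prob) => _ _ <-; exact: m_le. Qed.

(** Construction of a Radon measure from a content: open sets are measured from inside by closed
    sets, then arbitrary sets from outside by open sets. Only the values of [m] on closed sets
    enter. *)
Definition inner_content (O : set T) : \bar R :=
  ereal_sup [set (m C)%:E | C in [set C | closed C /\ C `<=` O]].

Definition outer_content (A : set T) : \bar R :=
  ereal_inf [set inner_content O | O in [set O | open O /\ A `<=` O]].

Local Notation lam := inner_content.
Local Notation mstar := outer_content.

Let le_lam C O : closed C -> C `<=` O -> (m C)%:E <= lam O.
Proof. by move=> cC CO; apply: ereal_sup_ubound; exists C. Qed.

Let lam_ge0 O : 0 <= lam O.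
Proof.
apply: le_trans (le_lam closed0 (@sub0set _ O)).
by rewrite lee_fin.
Qed.

Let lam_le1 O : lam O <= 1.
Proof. by apply: ge_ereal_sup => _ [C _ <-]; rewrite lee_fin. Qed.

Let lamS O O' : O `<=` O' -> lam O <= lam O'.
Proof.
move=> OO'; apply: ge_ereal_sup => _ [C [cC CO] <-].
by apply: le_lam => //; exact: subset_trans OO'.
Qed.

Let fin_bounded (x : \bar R) : 0 <= x -> x <= 1 -> x \is a fin_num.
Proof.
by move=> x0 x1; rewrite ge0_fin_numE//; exact: le_lt_trans x1 (ltry _).
Qed.

Let lam_fin O : lam O \is a fin_num.
Proof. exact: fin_bounded. Qed.

Let lam_approx O (e : R) : (0 < e)%R ->
  exists C, [/\ closed C, C `<=` O & lam O <= (m C + e)%:E].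
Proof.
move=> e0; have [_ [C [cC CO] <-] /ltW Ce] := ub_ereal_sup_adherent e0
  (lam_fin O).
exists C; split=> //; rewrite EFinD -leeBlDr//; exact: Ce.
Qed.

(** By normality a closed subset of the union is covered by two closed pieces, one inside each open
    set. *)
Let lamU O O' : open O -> open O' -> lam (O `|` O') <= lam O + lam O'.
Proof.
move=> oO oO'; apply: ge_ereal_sup => _ [C [cC COO'] <-].
have [|||U [V [oU oV CU CV UV]]] :=
  (@normal_openP R T).1 (compact_normal hausT cptT) (C `\` O') (C `\` O).
- by rewrite setDE; apply: closedI => //; exact: open_closedC.
- by rewrite setDE; apply: closedI => //; exact: open_closedC.
- by rewrite -subset0 => x [[Cx nO'] [_ nO]]; case: (COO' _ Cx).
(* The disjoint open sets [U] and [V] contain the parts of [C] outside [O'] and outside [O];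
   removing [V] leaves a closed subset of [O], removing [U] one of [O']. *)
have CE : C `<=` (C `\` V) `|` (C `\` U).
  move=> x Cx; have [Vx|nVx] := pselect (V x); last by left.
  right; split=> // Ux; have : (U `&` V) x by [].
  by rewrite UV.
have : (m C)%:E <= (m (C `\` V))%:E + (m (C `\` U))%:E.
  by rewrite -EFinD lee_fin; apply: le_trans (m_le CE) (m_leU _ _).
move=> /le_trans; apply; apply: leeD; apply: le_lam.
- by rewrite setDE; apply: closedI => //; exact: open_closedC.
- by move=> x [Cx nV]; apply: contrapT => nO; apply/nV/CV.
- by rewrite setDE; apply: closedI => //; exact: open_closedC.
- by move=> x [Cx nU]; apply: contrapT => nO; apply/nU/CU.
Qed.

Let lam_bigU (O : (set T)^nat) n : (forall k, open (O k)) ->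
  lam (\big[setU/set0]_(k < n) O k) <= \sum_(k < n) lam (O k).
Proof.
move=> oO; elim: n => [|n IH].
  rewrite !big_ord0; apply: ge_ereal_sup => y [C [_]].
  by rewrite subset0 => -> <-; rewrite m0.
rewrite !big_ord_recr/=; apply: le_trans (lamU _ (oO n)) _.
  by rewrite -bigcup_mkord; apply: bigcup_open => i _; exact: oO.
exact: leeD2r.
Qed.

(** Closed sets are compact here, so each one inside the union already lies in a finite subunion.
    This is where countable additivity comes from, [m] being only finitely additive. *)
Let lam_bigcup (O : (set T)^nat) : (forall k, open (O k)) ->
  lam (\bigcup_k O k) <= \sum_(k <oo) lam (O k).
Proof.
move=> oO; apply: ge_ereal_sup => _ [C [cC CO] <-].
have cptC : compact C by exact: subclosed_compact cC cptT _.
have [n Cn] : exists n, C `<=` \big[setU/set0]_(k < n) O k.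
  apply: (@compact_ind T C
      (fun A => exists n, A `<=` \big[setU/set0]_(k < n) O k)) => //.
  - by exists 0%N.
  - move=> A B [n An] [k Bk]; exists (maxn n k) => x [/An|/Bk];
      rewrite -!bigcup_mkord; apply: bigcup_sub => i /= ik;
      by move=> y Oy; exists i => //=; rewrite leq_max ik ?orbT.
  - by move=> A B AB [n Bn]; exists n; exact: subset_trans Bn.
  - move=> x /CO[n _ Ox]; exists (O n).
      by apply: open_nbhs_nbhs; split.
    by exists n.+1; rewrite big_ord_recr/= => y; right.
apply: le_trans (le_lam cC Cn) _; apply: le_trans (lam_bigU n oO) _.
by rewrite -(big_mkord xpredT (fun k => lam (O k))); exact: nneseries_lim_ge.
Qed.

Let mstar_le A O : open O -> A `<=` O -> mstar A <= lam O.
Proof. by move=> oO AO; apply: ereal_inf_lbound; exists O. Qed.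

Let mstar_ge0 A : 0 <= mstar A.
Proof. by apply: le_ereal_inf_tmp => _ [ O _ <-]. Qed.

Let mstar_fin A : mstar A \is a fin_num.
Proof.
apply: fin_bounded => //; apply: le_trans (mstar_le openT (@subsetT _ A)) _.
exact: lam_le1.
Qed.

Let mstar_open O : open O -> mstar O = lam O.
Proof.
move=> oO; apply/eqP; rewrite eq_le mstar_le//=.
by apply: le_ereal_inf_tmp => _ [ O' [_ OO'] <-]; exact: lamS.
Qed.

Let mstar0 : mstar set0 = 0.
Proof.
apply/eqP; rewrite eq_le mstar_ge0 andbT mstar_open; last exact: open0.
by have := lam_bigU 0 (fun=> openT); rewrite !big_ord0.
Qed.

Let mstarS : {homo mstar : A B / A `<=` B >-> A <= B}.
Proof.
move=> A B AB; apply: le_ereal_inf_tmp => _ [ O [oO BO] <-].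
by apply: mstar_le => //; exact: subset_trans BO.
Qed.

Let mstar_approx A (e : R) : (0 < e)%R ->
  exists O, [/\ open O, A `<=` O & lam O <= mstar A + e%:E].
Proof.
move=> e0; have [_ [ O [oO AO] <-] /ltW Oe] := lb_ereal_inf_adherent e0
  (mstar_fin A).
by exists O.
Qed.

Let mstar_sigma : sigma_subadditive mstar.
Proof.
move=> F; apply/lee_addgt0Pr => e e0.
have e2 n : (0 < e / (2 ^ n.+1)%:R)%R by rewrite divr_gt0// ltr0n expn_gt0.
pose O n := sval (cid (mstar_approx (F n) (e2 n))).
have OP n : [/\ open (O n), F n `<=` O n &
    lam (O n) <= mstar (F n) + (e / (2 ^ n.+1)%:R)%:E].
  exact: (svalP (cid (mstar_approx (F n) (e2 n)))).
apply: le_trans (epsilon_trick xpredT _ (ltW e0)) => //.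
apply: (@le_trans _ _ (\sum_(k <oo) lam (O k))); last first.
  by apply: lee_nneseries => // n _; have [] := OP n.
apply: le_trans (lam_bigcup _); last by move=> n; have [] := OP n.
apply: mstar_le; first by apply: bigcup_open => n _; have [] := OP n.
by apply: subset_bigcup => n _; have [] := OP n.
Qed.

HB.instance Definition _ := isOuterMeasure.Build R T mstar
  mstar0 mstar_ge0 mstarS mstar_sigma.

(** Choose an open [W] around [X], a closed [C] nearly exhausting the part of [W] in [O], and a
    closed [D] nearly exhausting the rest of [W] outside [C]. As [C] and [D] are disjoint,
    [m C + m D] is at most the content of [W]; each of the three approximations costs [e / 3]. *)
Let mstar_caratheodory O : open O -> mstar.-caratheodory O.
Proof.
move=> oO; apply: le_caratheodory_measurable => X; apply/lee_addgt0Pr => e e0.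
change (mstar (X `&` O) + mstar (X `&` ~` O) <= mstar X + e%:E).
have e3 : (0 < e / 3)%R by rewrite divr_gt0.
have [W [oW XW We]] := mstar_approx X e3.
have [C [cC CWO Ce]] := lam_approx (W `&` O) e3.
have oWC : open (W `&` ~` C) by apply: openI => //; exact: closed_openC.
have [D [cD DWC De]] := lam_approx (W `&` ~` C) e3.
have h1 : mstar (X `&` O) <= lam (W `&` O).
  by apply: mstar_le => [|x [/XW Wx Ox]//]; exact: openI.
have h2 : mstar (X `&` ~` O) <= lam (W `&` ~` C).
  by apply: mstar_le => // x [/XW Wx nOx]; split=> // /CWO[].
have h3 : (m C + m D)%:E <= lam W.
  have [_ mU _] := m_prob; rewrite -mU; last first.
    by rewrite -subset0 => x [Cx /DWC[]].
  apply: le_lam; first exact: closedU.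
  by move=> x [/CWO[]|/DWC[]].
(* All six values are finite, so destructing them leaves linear arithmetic over the reals. *)
move: (mstar (X `&` O)) (mstar (X `&` ~` O)) (mstar X) (lam (W `&` O))
  (lam (W `&` ~` C)) (lam W) (mstar_fin (X `&` O)) (mstar_fin (X `&` ~` O))
  (mstar_fin X) (lam_fin (W `&` O)) (lam_fin (W `&` ~` C)) (lam_fin W)
  We Ce De h1 h2 h3.
move=> [a||] [b||] [c||] [a'||] [b'||] [c'||] //.
by rewrite -!EFinD !lee_fin; move=> *; lra.
Qed.

Let measurable_caratheodory (A : set (borel T)) :
  measurable A -> mstar.-caratheodory A.
Proof.
apply: smallest_sub => [|O oO]; last exact: mstar_caratheodory.
split.
- exact: caratheodory_measurable_set0.
- by move=> B mB; rewrite setTD; exact: caratheodory_measurable_setC.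
- by move=> F mF; exact: caratheodory_measurable_bigcup.
Qed.

Let borel_sigma_additive :
  semi_sigma_additive (mstar : set (borel T) -> \bar R).
Proof.
move=> F mF tF mUF.
apply: (@caratheodory_measure_sigma_additive R T mstar F) => //.
- by move=> i; exact: measurable_caratheodory (mF i).
- exact: measurable_caratheodory mUF.
Qed.

HB.instance Definition _ := isMeasure.Build _ (borel T) R
  (mstar : set (borel T) -> \bar R) mstar0 mstar_ge0 borel_sigma_additive.

Let mstarT : (mstar : set (borel T) -> \bar R) [set: borel T] = 1.
Proof.
apply/eqP; rewrite mstar_open; last exact: openT.
rewrite eq_le lam_le1/=.
have [_ _ mT] := m_prob; rewrite -mT.
by apply: le_lam => //; exact: closedT.
Qed.

HB.instance Definition _ := Measure_isProbability.Build _ (borel T) R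
  (mstar : set (borel T) -> \bar R) mstarT.

(** Every open set around a closed [C] has inner content at least [m C], whence the domination.
    Outer regularity holds by construction, and inner regularity is outer regularity of the
    complement. *)
Lemma finitely_additive_regular_measure :
  exists mu : probability (borel T) R, regular_measure mu /\
    forall C : set T, closed C -> (m C)%:E <= mu C.
Proof.
exists (mstar : set (borel T) -> \bar R); split; last first.
  move=> C cC; apply: le_ereal_inf_tmp => _ [ O [oO CO] <-]; exact: le_lam.
have outer (Y : set (borel T)) : mstar Y =
    ereal_inf [set mstar O | O in [set O : set T | open O /\ Y `<=` O]].
  rewrite {1}/outer_content; congr ereal_inf; apply/seteqP;
    split=> _ [ O [oO YO] <-].
    by exists O => //; rewrite mstar_open.
  by exists O => //; rewrite mstar_open.
move=> Y mY; split; first exact: outer.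
pose P : probability (borel T) R := (mstar : set (borel T) -> \bar R).
apply/eqP; rewrite eq_le; apply/andP; split; last first.
  apply: ge_ereal_sup => _ [C [_ CY] <-]; exact: mstarS.
apply/lee_addgt0Pr => e e0.
have [ O [oO YO Oe]] := mstar_approx (~` Y) e0.
have cO : closed (~` O) by exact: open_closedC.
have mO : measurable (O : set (borel T)) by exact: sub_sigma_algebra.
apply: (@le_trans _ _ (mstar (~` O) + e%:E)); last first.
  apply: leeD2r; apply: ereal_sup_ubound; exists (~` O) => //; split=> //.
  by move=> x nOx; apply: contrapT => nYx; apply/nOx/YO.
have := probability_setC P mY; have := probability_setC P mO.
rewrite /P /= => -> Y'; move: Oe; rewrite Y' -(mstar_open oO).
move: (mstar Y) (mstar O) (mstar_fin Y) (mstar_fin O) => [a||] [b||] // _ _.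
by rewrite -?EFinB -!EFinD !lee_fin; move=> *; lra.
Qed.

End RegularMeasure.

(** * The cone generated by the states *)

(** The infimum of [x] and [z] serves as [a], which forces the other three parts. The only
    membership with content is that of [d]: it says that [x] is below [a + w], which holds because
    [x] is below both [x + w] and [z + w]. *)
Lemma lattice_cone_riesz (R : realType) (V : lmodType R) (C : set V)
    (x y z w : V) : lattice_cone C -> C x -> C y -> C z -> C w ->
  x + y = z + w ->
  exists a b c d, [/\ C a, C b, C c & C d] /\
    [/\ x = a + b, y = c + d, z = a + c & w = b + d].
Proof.
move=> [[[C0 CD] _] latC] Cx Cy Cz Cw xyzw.
have CU u v : C u -> C v -> C (u + v).
  by move=> Cu Cv; have := CD 1 1 u v ler01 ler01 Cu Cv; rewrite !scale1r.
have [_ [m Cm [mx mz mP]]] := latC _ _ Cx Cz.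
have [_ [n Cn [nx nz nP]]] := latC _ _ (CU _ _ Cx Cw) (CU _ _ Cz Cw).
(* Translation by [w] preserves infima taken in the cone: [n = m + w]. *)
have wn : C (n - w) by apply: nP => //; rewrite /cone_le addrK.
have xn : C (n - x).
  apply: nP => //; first by rewrite /cone_le addrAC subrr add0r.
  by rewrite /cone_le -xyzw addrAC subrr add0r.
have nm : C (m - (n - w)).
  by apply: mP => //; rewrite /cone_le opprB addrA.
exists m, (x - m), (z - m), (w - (x - m)); split; first split=> //.
  have := CU _ _ nm xn; congr C.
  by rewrite !opprB addrA -(addrA m) subrK addrA [m + w]addrC.
split; rewrite ?subrKC//.
rewrite opprB addrA [z - m + w]addrAC -xyzw.
by rewrite addrA subrK [x + y]addrC addrK.
Qed.

Lemma riesz_real (R : realType) (x y z w : R) : 0 <= x -> 0 <= y -> 0 <= z -> 0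
  <= w ->
  x + y = z + w ->
  exists a b c d, [/\ 0 <= a, 0 <= b, 0 <= c & 0 <= d] /\
    [/\ x = a + b, y = c + d, z = a + c & w = b + d].
Proof.
move=> x0 y0 z0 w0 e; have [xz|zx] := leP x z.
  exists x, 0, (z - x), w; split; split; lra.
by exists z, (x - z), 0, y; split; split; lra.
Qed.

Section StateCone.
Variables (E : effectAlgebraType) (R : realType).
Local Notation X := (ptws_space E R).
Implicit Types (p q : X) (a b c : E).

Definition state_cone : set X :=
  [set p | (forall a, 0 <= p a) /\
           forall a b c, padd a b = Some c -> p c = p a + p b].

Lemma ptws_addE p q a : (p + q) a = p a + q a. Proof. by []. Qed.
Lemma ptws_scaleE (t : R) p a : (t *: p) a = t * p a. Proof. by []. Qed.
Lemma ptws_zeroE a : (0 : X) a = 0. Proof. by []. Qed.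

Lemma state_cone0 : state_cone 0.
Proof. by split=> [a|a b c _]; rewrite !ptws_zeroE// addr0. Qed.

Lemma state_coneD p q : state_cone p -> state_cone q -> state_cone (p + q).
Proof.
move=> [p0 pD] [q0 qD]; split=> [a|a b c abc]; rewrite !ptws_addE.
  exact: addr_ge0.
by rewrite (pD _ _ _ abc) (qD _ _ _ abc) addrACA.
Qed.

Lemma state_coneZ (t : R) p : 0 <= t -> state_cone p -> state_cone (t *: p).
Proof.
move=> t0 [p0 pD]; split=> [a|a b c abc]; rewrite !ptws_scaleE.
  exact: mulr_ge0.
by rewrite (pD _ _ _ abc) mulrDr.
Qed.

Lemma state_cone_orthosupplement p a : state_cone p ->
  exists a', p pone = p a + p a'.
Proof.
by move=> [_ pD]; have [a' [aa' _]] := orthosupplement a; exists a'; exact: pD.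
Qed.

Lemma state_cone_le p a : state_cone p -> p a <= p pone.
Proof.
move=> pC; have [a' ->] := state_cone_orthosupplement a pC.
by rewrite lerDl; exact: pC.1.
Qed.

Lemma state_cone_eq0 p : state_cone p -> p pone = 0 -> p = 0.
Proof.
move=> pC p0; apply/funext => a; apply/eqP; rewrite eq_le ptws_zeroE pC.1.
by rewrite andbT -p0 state_cone_le.
Qed.

Lemma statesP p : states E R p <-> state_cone p /\ p pone = 1.
Proof.
split=> [[p01 p1 pD]|[pC p1]].
  by split=> //; split=> // a; have /andP[] := p01 a.
split=> //; last exact: pC.2.
by move=> a; rewrite pC.1 -p1 state_cone_le.
Qed.

Lemma state_cone_normalize p : state_cone p -> p pone != 0 ->
  states E R ((p pone)^-1 *: p).
Proof.
move=> pC p0; apply/statesP; split.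
  by apply: state_coneZ => //; rewrite invr_ge0; exact: pC.1.
by rewrite ptws_scaleE mulVf.
Qed.

Lemma state_coneP p : state_cone p ->
  p = 0 \/ exists x (t : R), [/\ 0 < t, states E R x & p = t *: x].
Proof.
move=> pC; have [/(state_cone_eq0 pC)|p0] := eqVneq (p pone) 0; first by left.
right; exists ((p pone)^-1 *: p), (p pone); split.
- by rewrite lt_neqAle eq_sym p0; exact: pC.1.
- exact: state_cone_normalize.
- by rewrite scalerA mulfV// scale1r.
Qed.

Definition riesz_decomposition : Prop :=
  forall p q r t, state_cone p -> state_cone q -> state_cone r ->
    state_cone t -> p + q = r + t ->
    exists a b c d : X,
      [/\ state_cone a, state_cone b, state_cone c & state_cone d] /\
      [/\ p = a + b, q = c + d, r = a + c & t = b + d].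

(** The cone is then zero or a single ray, and the decomposition is that of real numbers. This
    settles the degenerate case of [simplex_riesz]. *)
Lemma riesz_subsingleton :
  (forall x y, states E R x -> states E R y -> x = y) -> riesz_decomposition.
Proof.
move=> K1.
have [[e Ke]|K0] := pselect (exists e, states E R e); last first.
  have z p : state_cone p -> p = 0.
    by move=> /state_coneP[//|[x [_ [_ Kx _]]]]; case: K0; exists x.
  move=> p q r t /z-> /z-> /z-> /z-> _; exists 0, 0, 0, 0.
  by rewrite addr0; split; split=> //; exact: state_cone0.
have [eC e1] := (statesP e).1 Ke.
have coneE p : state_cone p -> p = p pone *: e.
  move=> /state_coneP[->|[x [s [s0 Kx ->]]]];
    first by rewrite ptws_zeroE scale0r.
  by rewrite (K1 _ _ Kx Ke) ptws_scaleE e1 mulr1.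
move=> p q r t pC qC rC tC e2.
have := congr1 (fun f : X => f pone) e2; rewrite /= !ptws_addE => /riesz_real.
move=> [||||a [b [c [d [[a0 b0 c0 d0] [pe qe re te]]]]]]; [exact: pC.1|
  exact: qC.1|exact: rC.1|exact: tC.1|].
exists (a *: e), (b *: e), (c *: e), (d *: e); split.
  by split; exact: state_coneZ.
by rewrite -!scalerDl -pe -qe -re -te; split; exact: coneE.
Qed.

(** The affine isomorphism [f] from the states to the base [L] extends by homogeneity to an additive
    bijection [phi] from the cone of states to [C], along which the decomposition in [C] is pulled
    back. *)
Lemma simplex_riesz : simplex (states E R) -> riesz_decomposition.
Proof.
move=> [_ [V [C [L [latC [cvxL LC baseL] [f [bijf afff]]]]]]].
have [[CC _] _] := latC.
have [fKL finj fsurj] := bijf.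
have injK x y : states E R x -> states E R y -> f x = f y -> x = y.
  by move=> Kx Ky; apply: finj; exact: mem_set.
(* The definition of a base lets it contain [0], but then it has no other point: for a nonzero [l]
   in [L], half of [l] is in [L] by convexity, and [l] is both [1] times [l] and [2] times its
   half. *)
have [L0|L0] := pselect (L 0).
  apply: riesz_subsingleton.
  suff L1 l : L l -> l = 0.
    move=> x y Kx Ky; apply: injK => //.
    by rewrite (L1 _ (fKL _ Kx)) (L1 _ (fKL _ Ky)).
  move=> Ll; apply: contrapT => l0.
  have h0 : (0 : R) <= 2^-1 by rewrite invr_ge0.
  have h1 : (2^-1 : R) <= 1 by lra.
  have /set_mem := cvxL l 0 (Itv01 h0 h1) (mem_set Ll) (mem_set L0).
  rewrite /conv/= scaler0 addr0 => Ll2.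
  have [[u v] [_ uniq]] := baseL _ (LC _ Ll) l0.
  have [u1 _] : (u, v) = (1, l) by apply: uniq; split=> //=; rewrite scale1r.
  have [u2 _] : (u, v) = (2, 2^-1 *: l).
    by apply: uniq; split=> //=; rewrite scalerA mulfV// scale1r.
  by move: u1; rewrite u2; lra.
pose phi p := p pone *: f ((p pone)^-1 *: p).
have phi0 : phi 0 = 0 by rewrite /phi ptws_zeroE scale0r.
have phi_scale (s : R) x : 0 < s -> states E R x -> phi (s *: x) = s *: f x.
  move=> s0 /statesP[_ x1]; rewrite /phi ptws_scaleE x1 mulr1 scalerA.
  by rewrite mulVf ?gt_eqF// scale1r.
have phiD p q : state_cone p -> state_cone q -> phi (p + q) = phi p + phi q.
  move=> /state_coneP[->|[x [s [s0 Kx ->]]]];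
    first by rewrite !add0r phi0 add0r.
  move=> /state_coneP[->|[y [u [u0 Ky ->]]]];
    first by rewrite !addr0 phi0 addr0.
  rewrite (phi_scale _ _ s0 Kx) (phi_scale _ _ u0 Ky).
  have su : 0 < s + u by exact: addr_gt0.
  have tE : 1 - s / (s + u) = u / (s + u).
    by rewrite -[1](@divff _ (s + u)) ?gt_eqF// -mulrBl addrAC subrr add0r.
  have t01 : 0 <= s / (s + u) <= 1.
    by rewrite (divr_ge0 (ltW s0) (ltW su))/= ler_pdivrMr// mul1r lerDl ltW.
  (* Dividing by the total mass turns the sum into a convex combination of states, where [f] is
     known to be affine. *)
  set w := (s / (s + u)) *: x + (u / (s + u)) *: y.
  have wE : s *: x + u *: y = (s + u) *: w.
    by rewrite scalerDr !scalerA ![(s + u) * _]mulrC !divfK ?gt_eqF.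
  have Kw : states E R w.
    apply/statesP; have [xC x1] := (statesP x).1 Kx.
    have [yC y1] := (statesP y).1 Ky; split.
      by apply: state_coneD; apply: state_coneZ => //; rewrite divr_ge0// ltW.
    by rewrite /w ptws_addE !ptws_scaleE x1 y1 !mulr1 -mulrDl divff// gt_eqF.
  rewrite wE phi_scale// /w -tE afff// tE scalerDr !scalerA.
  by rewrite ![(s + u) * _]mulrC !divfK ?gt_eqF.
have phiC p : state_cone p -> C (phi p).
  move=> pC; have [->|[x [s [s0 Kx ->]]]] := state_coneP pC.
    by rewrite phi0; exact: CC.1.
  rewrite phi_scale//; have := CC.2 s 0 (f x) (f x) (ltW s0) (lexx _).
  by rewrite scale0r addr0; apply; apply/LC/fKL.
have phi_surj y : C y -> exists2 p, state_cone p & phi p = y.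
  move=> Cy; have [->|y0] := pselect (y = 0); first by exists 0;
    [exact: state_cone0|].
  have [[s l] [[/= s0 Ll yE] _]] := baseL _ Cy y0.
  have [x Kx fx] := fsurj _ Ll; exists (s *: x).
    by apply: state_coneZ => //; exact: ((statesP x).1 Kx).1.
  rewrite phi_scale ?fx// lt_neqAle s0 andbT eq_sym.
  by apply/eqP => sz; apply: y0; rewrite yE sz scale0r.
have scale_neq0 (s : R) x : 0 < s -> states E R x -> s *: f x <> 0.
  move=> s0 Kx /(congr1 (fun v => s^-1 *: v)); rewrite scaler0 scalerA.
  by rewrite mulVf ?gt_eqF// scale1r => fx0; apply: L0; rewrite -fx0;
    exact: fKL.
(* Injectivity on nonzero elements is the uniqueness of coordinates with respect to the base. *)
have phi_inj p q : state_cone p -> state_cone q -> phi p = phi q -> p = q.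
  move=> /state_coneP[->|[x [s [s0 Kx ->]]]].
    move=> /state_coneP[->//|[y [u [u0 Ky ->]]]].
    by rewrite phi0 phi_scale// => /esym /scale_neq0; case.
  move=> /state_coneP[->|[y [u [u0 Ky ->]]]].
    by rewrite phi0 phi_scale// => /scale_neq0; case.
  rewrite !phi_scale// => e.
  have [||z [_ uniq]] := baseL (s *: f x).
  - by rewrite -(phi_scale _ _ s0 Kx); apply/phiC/state_coneZ;
      [exact: ltW|exact: ((statesP x).1 Kx).1].
  - exact: scale_neq0.
  have h1 : z = (s, f x) by apply: uniq; split=> //=; [exact: ltW|exact: fKL].
  have h2 : z = (u, f y) by apply: uniq; split=> //=; [exact: ltW|exact: fKL].
  by move: h1; rewrite h2 => -[-> /injK ->].
move=> p q r t pC qC rC tC e.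
have [|a [b [c [d [[Ca Cb Cc Cd] [pe qe re te]]]]]] := lattice_cone_riesz latC
  (phiC _ pC) (phiC _ qC) (phiC _ rC) (phiC _ tC).
  by rewrite -!phiD// e.
have [a' a'C a'E] := phi_surj _ Ca; have [b' b'C b'E] := phi_surj _ Cb.
have [c' c'C c'E] := phi_surj _ Cc; have [d' d'C d'E] := phi_surj _ Cd.
exists a', b', c', d'; split=> //; split; apply: phi_inj => //;
  by [exact: state_coneD|rewrite phiD// a'E ?b'E ?c'E ?d'E|
      rewrite phiD// ?a'E ?b'E ?c'E ?d'E].
Qed.

End StateCone.
Arguments state_cone : clear implicits.
Arguments riesz_decomposition : clear implicits.

(** * Suprema of functionals on the cone of states *)

Section Envelope.
Variables (E : effectAlgebraType) (R : realType).
Local Notation X := (ptws_space E R).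
Local Notation cone := (state_cone E R).
Implicit Types (p q r : X) (l : seq (R * E)) (L : seq (seq (R * E))).

Definition lincomb l p : R := \sum_(i <- l) i.1 * p i.2.

(** The seed [0] puts the zero functional among the maximised ones, as in [envelope], so these
    functions are nonnegative. *)
Definition max_lincomb L p : R :=
  foldr (fun l m => Num.max (lincomb l p) m) 0 L.

(* On the cone of states this is the supremum of the functionals [0] and
   [lincomb l], for [l] in [L], in the lattice of additive functionals, given
   by the Riesz-Kantorovich formula. *)
Fixpoint envelope L p : R :=
  if L is l :: L' then
    sup [set lincomb l qr.1 + envelope L' qr.2 |
         qr in [set qr : X * X | [/\ cone qr.1, cone qr.2 & qr.1 + qr.2 = p]]]
  else 0.

Lemma lincombD l p q : lincomb l (p + q) = lincomb l p + lincomb l q.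
Proof.
by rewrite -big_split/=; apply: eq_bigr => i _; rewrite ptws_addE mulrDr.
Qed.

Lemma lincombZ l (t : R) p : lincomb l (t *: p) = t * lincomb l p.
Proof.
by rewrite mulr_sumr; apply: eq_bigr => i _; rewrite ptws_scaleE mulrCA.
Qed.

Lemma lincomb_bounded l :
  exists2 B, 0 <= B & forall p, cone p -> `|lincomb l p| <= B * p pone.
Proof.
exists (\sum_(i <- l) `|i.1|); first exact: sumr_ge0.
move=> p pC; apply: le_trans (ler_norm_sum _ _ _) _.
rewrite mulr_suml; apply: ler_sum => i _; rewrite normrM ler_wpM2l//.
by rewrite ger0_norm ?state_cone_le//; exact: pC.1.
Qed.

Let decomp l L p := [set lincomb l qr.1 + envelope L qr.2 |
  qr in [set qr : X * X | [/\ cone qr.1, cone qr.2 & qr.1 + qr.2 = p]]].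

Let envelope_cons l L p : envelope (l :: L) p = sup (decomp l L p).
Proof. by []. Qed.

Let decomp_nonempty l L p : cone p -> decomp l L p !=set0.
Proof.
move=> pC; exists (lincomb l 0 + envelope L p); exists (0, p) => //=.
by split=> //; [exact: state_cone0|rewrite add0r].
Qed.

(** A real [sup] is an upper bound only for a set that is bounded above; this bound supplies that
    for [envelope_ge]. *)
Lemma envelope_bounded L :
  exists2 B, 0 <= B & forall p, cone p -> envelope L p <= B * p pone.
Proof.
elim: L => [|l L [B B0 LB]].
  by exists 0 => // p _; rewrite mul0r.
have [B' B'0 lB] := lincomb_bounded l.
exists (B + B'); first exact: addr_ge0.
move=> p pC; rewrite envelope_cons; apply: sup_le_ub;
  first exact: decomp_nonempty.
move=> _ [[q r] /= [qC rC <-] <-].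
have := LB _ rC; have := lB _ qC; have := qC.1 pone; have := rC.1 pone.
have := ler_norm (lincomb l q); rewrite ptws_addE => h1 h2 h3 h4 h5.
have := mulr_ge0 B0 h3; have := mulr_ge0 B'0 h2.
by move=> *; lra.
Qed.

Lemma envelope_ge l L q r : cone q -> cone r ->
  lincomb l q + envelope L r <= envelope (l :: L) (q + r).
Proof.
move=> qC rC; rewrite envelope_cons; apply: ub_le_sup; last by exists (q, r).
have [B B0 LB] := envelope_bounded L; have [B' B'0 lB] := lincomb_bounded l.
exists ((B + B') * (q + r) pone) => _ [[q' r'] /= [q'C r'C <-] <-].
have := LB _ r'C; have := lB _ q'C; have := q'C.1 pone; have := r'C.1 pone.
have := ler_norm (lincomb l q'); rewrite ptws_addE => h1 h2 h3 h4 h5.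
have := mulr_ge0 B0 h3; have := mulr_ge0 B'0 h2.
by move=> *; lra.
Qed.

Lemma envelope_le l L p M : cone p ->
  (forall q r, cone q -> cone r -> q + r = p ->
     lincomb l q + envelope L r <= M) ->
  envelope (l :: L) p <= M.
Proof.
move=> pC H; rewrite envelope_cons; apply: sup_le_ub;
  first exact: decomp_nonempty.
by move=> _ [[q r] /= [qC rC qr] <-]; exact: H.
Qed.

(** Adding decompositions of [p] and [q] gives one of [p + q], hence superadditivity. Conversely,
    Riesz decomposition refines any decomposition of [p + q] into one of [p] and one of [q]. *)
Lemma envelopeD L p q : riesz_decomposition E R -> cone p -> cone q ->
  envelope L (p + q) = envelope L p + envelope L q.
Proof.
move=> rdp; elim: L p q => [|l L IH] p q pC qC; first by rewrite /= addr0.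
apply/eqP; rewrite eq_le; apply/andP; split.
  apply: envelope_le; first exact: state_coneD.
  move=> u v uC vC /esym/rdp.
  move=> []// a [b [c [d [[aC bC cC dC] [-> -> -> ->]]]]].
  rewrite lincombD IH//.
  have := envelope_ge l L aC bC; have := envelope_ge l L cC dC.
  by move=> *; lra.
rewrite -lerBrDr; apply: envelope_le => // a b aC bC ab.
rewrite lerBrDr addrC -lerBrDr; apply: envelope_le => // c d cC dC cd.
rewrite lerBrDr -ab -cd [in leRHS]addrACA.
have := envelope_ge l L (state_coneD aC cC) (state_coneD bC dC).
by rewrite lincombD IH//; move=> *; lra.
Qed.

Lemma envelopeZ_le L (t : R) p : 0 < t -> cone p ->
  envelope L (t *: p) <= t * envelope L p.
Proof.
move=> t0; elim: L p => [|l L IH] p pC; first by rewrite /= mulr0.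
have tC q : cone q -> cone (t^-1 *: q).
  by apply: state_coneZ; rewrite invr_ge0 ltW.
have tE q : q = t *: (t^-1 *: q).
  by rewrite scalerA mulfV ?gt_eqF// scale1r.
apply: envelope_le; first by apply: state_coneZ => //; exact: ltW.
move=> q r qC rC qr.
rewrite [in lincomb _ _](tE q) [in envelope _ _](tE r) lincombZ.
have := IH _ (tC _ rC); have := envelope_ge l L (tC _ qC) (tC _ rC).
rewrite -scalerDr qr scalerA mulVf ?gt_eqF// scale1r => h1 h2.
have := ler_wpM2l (ltW t0) h1; rewrite mulrDr => h3.
by apply: le_trans h3; rewrite lerD2l.
Qed.

(** After normalization, [q] and [r] exhibit [e] as a convex combination of two states with weights
    [q pone / t] and [r pone / t]; extremality makes both equal to [e]. *)
Lemma extreme_state_decomp (e q r : X) (t : R) :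
  extreme_points (states E R) e -> cone q -> cone r -> q + r = t *: e ->
  q = q pone *: e.
Proof.
move=> [Ke ext] qC rC qr.
have e1 : e pone = 1 by case/statesP: Ke.
have tE : t = q pone + r pone.
  by have := congr1 (fun f : X => f pone) qr;
    rewrite /= ptws_addE ptws_scaleE e1 mulr1.
have [q0|q0] := eqVneq (q pone) 0.
  by rewrite (state_cone_eq0 qC q0) ptws_zeroE scale0r.
have [r0|r0] := eqVneq (r pone) 0.
  by move: qr; rewrite (state_cone_eq0 rC r0) addr0 tE r0 addr0.
have q1 : 0 < q pone by rewrite lt_neqAle eq_sym q0; exact: qC.1.
have r1 : 0 < r pone by rewrite lt_neqAle eq_sym r0; exact: rC.1.
have t0 : 0 < t by rewrite tE addr_gt0.
have [||<- _] := ext (q pone / t) _ _ (state_cone_normalize qC q0)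
    (state_cone_normalize rC r0).
- by rewrite divr_gt0//= ltr_pdivrMr// mul1r tE ltrDl.
- have -> : 1 - q pone / t = r pone / t.
    by rewrite -[1](@divff _ t) ?gt_eqF// -mulrBl tE addrAC subrr add0r.
  rewrite !scalerA ![_ / t * _]mulrAC !mulfV// !mul1r -scalerDr qr.
  by rewrite scalerA mulVf ?gt_eqF// scale1r.
by rewrite scalerA mulfV// scale1r.
Qed.

(** Every decomposition of [t *: e] has the form [u *: e + v *: e] with [u + v = t], so splitting
    gains nothing over the pointwise maximum. *)
Lemma envelope_extreme L e (t : R) : extreme_points (states E R) e -> 0 <= t ->
  envelope L (t *: e) <= t * max_lincomb L e.
Proof.
move=> exte; have eC : cone e by have [/statesP[]] := exte.
elim: L t => [|l L IH] t t0 /=; first by rewrite mulr0.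
apply: envelope_le; first exact: state_coneZ.
move=> q r qC rC qr; have := extreme_state_decomp exte qC rC qr.
have := extreme_state_decomp exte rC qC (etrans (addrC _ _) qr).
move: (qC.1 pone) (rC.1 pone).
have tE : t = q pone + r pone.
  have := congr1 (fun f : X => f pone) qr.
  by rewrite /= ptws_addE ptws_scaleE; have [/statesP[_ ->]] := exte;
    rewrite mulr1.
rewrite tE; move: (q pone) (r pone) => u v u0 v0 -> ->.
rewrite lincombZ mulrDl; apply: lerD; first by rewrite ler_wpM2l// le_max lexx.
by apply: le_trans (IH _ v0) _; rewrite ler_wpM2l// le_max lexx orbT.
Qed.

End Envelope.

(** * Upper semicontinuity of the envelope *)

Lemma continuous_lincomb (R : realType) (E : Type) (T : topologicalType)
  (f : E -> T -> R^o) (l : seq (R * E)) : (forall a, continuous (f a)) ->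
  continuous (fun x => \sum_(i <- l) i.1 * f i.2 x : R^o).
Proof.
move=> fc x; elim: l => [|i l IH].
  rewrite (_ : (fun x => _) = cst 0); first by exact: cvg_cst.
  by apply/funext => y; rewrite big_nil.
rewrite (_ : (fun x => _) =
    fun x => i.1 * f i.2 x + \sum_(i <- l) i.1 * f i.2 x); last first.
  by apply/funext => y; rewrite big_cons.
apply: (@cvgD _ R^o); last exact: IH.
apply: (@cvgMl_tmp R T (nbhs x) _ (f i.2) i.1).
exact: fc.
Qed.

Section EnvelopeTopology.
Variables (E : effectAlgebraType) (R : realType).
Local Notation X := (ptws_space E R).
Local Notation cone := (state_cone E R).
Implicit Types (p q r : X) (l : seq (R * E)) (L : seq (seq (R * E))).

(** Truncating the cone at mass 1 makes it compact, while both terms of a decomposition of a member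
    remain members. *)
Definition bounded_state_cone : set X := [set p | cone p /\ p pone <= 1].
Local Notation cone1 := bounded_state_cone.

Lemma lincomb_continuous l : continuous (lincomb l : X -> R^o).
Proof.
apply: (@continuous_lincomb R E X (fun a q => q a)) => a.
exact: ptws_space_eval_continuous.
Qed.

Lemma bounded_state_cone_compact : states E R !=set0 ->
  compact (states E R) -> compact cone1.
Proof.
move=> [e Ke] cK.
have -> : cone1 = (fun z : R^o * X => z.1 *: z.2) @` (`[0, 1] `*` states E R).
  apply/seteqP; split=> [p [pC p1]|_ [[t x] /= [+ /statesP[xC x1]] <-]].
    have [->|[x [t [t0 Kx pE]]]] := state_coneP pC.
      by exists (0, e) => /=; rewrite ?scale0r// in_itv/= lexx ler01.
    have [_ x1] := (statesP x).1 Kx.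
    move: p1; rewrite pE ptws_scaleE x1 mulr1 => t1.
    by exists (t, x) => //; split=> //=; rewrite in_itv/= (ltW t0).
  rewrite in_itv/= => /andP[t0 t1]; split; first exact: state_coneZ.
  by rewrite ptws_scaleE x1 mulr1.
apply: continuous_compact.
  by apply: continuous_subspaceT => z; exact: scale_continuous.
by apply: compact_setX => //; exact: segment_compact.
Qed.

(** The envelope is a supremum over the fibres of addition on a compact set of pairs, of a function
    that is upper semicontinuous by induction. Such a supremum is upper semicontinuous. *)
Lemma envelope_usc L p (e : R) : states E R !=set0 -> compact (states E R) ->
  0 < e -> cone1 p ->
  \forall q \near p, cone1 q -> envelope L q < envelope L p + e.
Proof.
move=> K0 cK; have cC := bounded_state_cone_compact K0 cK.
elim: L p e => [|l L IH] p e e0 [pC p1].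
  by near=> q; rewrite /= add0r.
have /compact_near_coveringP ncov := compact_setX cC cC.
set M := envelope (l :: L) p.
have e4 : 0 < e / 4 by rewrite divr_gt0.
(* Near-covering compactness makes a local claim uniform over all pairs. A pair summing to [p] is
   handled by the semicontinuity of both terms, with [e / 4] each; any other pair has a
   neighbourhood whose sums avoid a neighbourhood of [p]. *)
have H : \forall q \near p, cone1 `*` cone1 `<=`
    [set x : X * X | cone1 x.2 -> x.1 + x.2 = q ->
      lincomb l x.1 + envelope L x.2 < M + e / 2].
  apply: (ncov X (nbhs p) (fun q x => cone1 x.2 -> x.1 + x.2 = q ->
    lincomb l x.1 + envelope L x.2 < M + e / 2)) => -[q r] [/= q1 r1].
  have [qr|/eqP qr] := pselect (q + r = p).
    have Nq : nbhs q [set x : X | lincomb l x < lincomb l q + e / 4].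
      have /cvgrPdist_lt /(_ _ e4) := @lincomb_continuous l q.
      apply: filterS => x /=; by rewrite ltr_distlC => /andP[].
    exists ([set x : X * X | lincomb l x.1 < lincomb l q + e / 4 /\
        (cone1 x.2 -> envelope L x.2 < envelope L r + e / 4)], setT).
      split=> /=; last exact: filterT.
      exists ([set x : X | lincomb l x < lincomb l q + e / 4],
        [set x : X | cone1 x -> envelope L x < envelope L r + e / 4]) => //=.
      by split; [exact: Nq|exact: (IH r _ e4 r1)].
    move=> [[u v] w] /= [[lu Lv] _] /Lv{}Lv _.
    have := envelope_ge l L q1.1 r1.1; rewrite qr -/M; lra.
  have := @ptws_space_hausdorff E R; rewrite open_hausdorff.
  move=> /(_ _ _ qr) [[A B] /= [Aqr Bp] [oA oB AB]].
  exists ([set x : X * X | A (x.1 + x.2)], B); first split=> /=.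
  - apply: (@add_continuous X (q, r)); apply: open_nbhs_nbhs; split=> //.
    exact: set_mem.
  - by apply: open_nbhs_nbhs; split=> //; exact: set_mem.
  - move=> [[u v] w] /= [Auv Bw] _ uvw; exfalso.
    have : (A `&` B) w by split=> //; rewrite -uvw.
    by rewrite (eqP AB).
near=> q => -[qC q1].
(* A supremum of values below [M + e / 2] may reach that bound; the other half of [e] keeps the
   inequality strict. *)
apply: (@le_lt_trans _ _ (M + e / 2)); last by rewrite ltrD2l; lra.
apply: envelope_le => // u v uC vC uv.
have le1 w : cone w -> w pone <= q pone -> cone1 w.
  by move=> wC wq; split=> //; exact: le_trans q1.
have u1 : cone1 u by apply: le1 => //; rewrite -uv ptws_addE lerDl; exact: vC.1.
have v1 : cone1 v by apply: le1 => //; rewrite -uv ptws_addE lerDr; exact: uC.1.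
by apply/ltW; apply: (near H q _ (u, v)).
Unshelve. all: by end_near. Qed.

(** Boxes restricting finitely many coordinates form a neighbourhood base, and a box contains every
    [q] that obeys the coordinatewise bounds valid on it. It is applied to normalized means of
    measures carried by [N']. *)
Lemma ptws_nbhs_hull p (N : set X) : nbhs p N ->
  exists2 N' : set X, nbhs p N' &
    forall q, (forall a (u v : R), (forall x, N' x -> u <= x a <= v) ->
      u <= q a <= v) -> N q.
Proof.
(* [{classic E}] provides the equality test behind list membership. *)
pose B (sd : seq {classic E} * R) : set X :=
  [set q | forall a, a \in sd.1 -> p a - sd.2 <= q a <= p a + sd.2].
pose F := filter_from [set sd : seq {classic E} * R | 0 < sd.2] B.
have FF : Filter F.
  apply: filter_from_filter; first by exists ([::], 1) => /=.
  move=> [s d] [s' d'] /= d0 d'0.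
  exists (s ++ s', Num.min d d'); first by rewrite /= lt_min d0.
  have dd : Num.min d d' <= d by rewrite ge_min lexx.
  have dd' : Num.min d d' <= d' by rewrite ge_min lexx orbT.
  move=> q H; split=> a /= sa; have /= := H a; rewrite mem_cat sa ?orbT;
    by move=> /(_ isT) /andP[h1 h2]; apply/andP; split;
      [apply: le_trans h1|apply: le_trans h2 _]; rewrite ?lerD2l// lerN2.
have /ptws_space_cvgP Fp : forall a, (fun q : X => q a) @ F --> p a.
  move=> a; apply/cvgrPdist_le => e e0.
  exists ([:: a : {classic E}], e) => // q /= /(_ a).
  by rewrite inE eqxx ler_distlC => /(_ isT).
move=> /Fp [[s d] /= d0 BN]; exists (B (s, d)); last first.
  by move=> q H; apply: BN => a sa; apply: H => x; exact.
rewrite /B /=; elim: s {BN} => [|a s IH]; first by apply: filterS filterT.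
have : nbhs p [set q : X | p a - d <= q a <= p a + d].
  have /cvgrPdist_le /(_ _ d0) := @ptws_space_eval_continuous E R a p.
  by apply: filterS => x /=; rewrite ler_distlC.
apply: filterS2 IH => q H1 H2 b; rewrite inE => /predU1P[->//|]; exact: H1.
Qed.

End EnvelopeTopology.

(** * The state space as a compact Hausdorff space *)

Section StateSpaceTopology.
Variables (E : effectAlgebraType) (R : realType) (s : states E R).
Local Notation X := (ptws_space E R).
Local Notation T := (state_space s).

Lemma state_val_continuous : continuous (fun x : T => \val x : X).
Proof. exact: initial_continuous. Qed.

Lemma state_space_hausdorff : hausdorff_space T.
Proof.
move=> x y xy; apply: val_inj; apply: (@ptws_space_hausdorff E R) => A B Ax By.
have [z [Az Bz]] := xy _ _ (state_val_continuous Ax) (state_val_continuous By).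
by exists (\val z).
Qed.

Lemma initial_compact (A : set X) : A `<=` states E R -> compact A ->
  compact [set x : T | A (\val x)].
Proof.
move=> AK cA F FF FA.
have FFv : ProperFilter ((fun x : T => \val x : X) @ F).
  exact: fmap_proper_filter.
have [p [Ap clp]] := cA _ FFv FA.
have Kp : p \in states E R by exact/mem_set/AK.
exists (exist _ p Kp : T); split=> // U V FU [W [[W' oW' <-]] /= W'p WV].
have FvU : ((fun x : T => \val x : X) @ F) ((fun x : T => \val x : X) @` U).
  by apply: (@filterS T F _ U) FU => x Ux; exists x.
have nW' : nbhs p W' by apply: open_nbhs_nbhs; split.
have [_ [[x Ux <-] W'x]] := clp _ _ FvU nW'.
by exists x; split=> //; exact: WV.
Qed.

Lemma state_space_compact : compact (states E R) -> compact [set: T].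
Proof.
move=> /(initial_compact (@subset_refl _ _)).
rewrite (_ : [set x | _] = setT)//; apply/seteqP; split=> // x _ /=.
exact/set_mem/valP.
Qed.

Lemma extreme_states_closed : compact (extreme_points (states E R)) ->
  closed (extreme_states s).
Proof.
move=> cX; apply: (compact_closed state_space_hausdorff).
by apply: initial_compact => // x [].
Qed.

Lemma eval_state_continuous a : continuous (fun x : T => (\val x : X) a : R^o).
Proof.
move=> x; apply: (@continuous_comp T X R^o (fun y => \val y) (fun q : X => q
  a)).
  exact: state_val_continuous.
exact: ptws_space_eval_continuous.
Qed.

Lemma lincomb_state_continuous l :
  continuous (fun x : T => lincomb l (\val x : X) : R^o).
Proof.
move=> x; apply: (@continuous_comp T X R^o); first exact: state_val_continuous.
exact: lincomb_continuous.
Qed.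

Lemma max_lincomb_state_continuous L :
  continuous (fun x : T => max_lincomb L (\val x : X) : R^o).
Proof.
elim: L => [|l L IH] x; first exact: (@cst_continuous T R^o 0).
apply: (@continuous_max R T (fun y => lincomb l (\val y))
  (fun y => max_lincomb L (\val y)) x); last exact: IH.
exact: lincomb_state_continuous.
Qed.

End StateSpaceTopology.

(** * Integrability of continuous functions on a compact space *)

Section ContinuousIntegrable.
Variables (R : realType) (T : ptopologicalType).

Lemma open_borel (O : set T) : open O -> measurable (O : set (borel T)).
Proof. exact: sub_sigma_algebra. Qed.

Lemma closed_borel (C : set T) : closed C -> measurable (C : set (borel T)).
Proof.
move=> cC; rewrite -(setCK C).
apply: (@measurableC _ (borel T)); apply: open_borel.
by apply: closed_openC.
Qed.

Lemma continuous_borel (f : T -> R^o) : continuous f ->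
  measurable_fun setT (f : borel T -> R).
Proof.
move=> cf; apply: (measurability _ (measurable_realfun.RGenOInfty.measurableE
  R)).
move=> _ [_ [a ->] <-]; rewrite setTI; apply: open_borel.
apply: open_comp => [x _|]; first exact: cf.
exact: interval_open.
Qed.

Lemma continuous_integrable (mu : probability (borel T) R) (f : T -> R^o)
    (A : set (borel T)) : compact [set: T] -> continuous f -> measurable A ->
  mu.-integrable A (EFin \o f).
Proof.
move=> cT cf mA; apply: measurable_bounded_integrable => //.
- by rewrite (le_lt_trans (probability_le1 mu mA))// ltry.
- by apply: measurable_funTS; exact: continuous_borel.
have [M [Mreal HM]] := compact_bounded (continuous_compact
  (continuous_subspaceT cf) cT).
by exists M; split=> // N /HM{}HM x _; apply: HM; exists x.
Qed.

End ContinuousIntegrable.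

(** * Barycenters *)

Section Barycenter.
Variables (E : effectAlgebraType) (R : realType) (s : states E R).
Local Notation X := (ptws_space E R).
Local Notation T := (state_space s).
Hypothesis cK : compact (states E R).
Variable mu : probability (borel T) R.
Implicit Types (A B : set (borel T)) (l : seq (R * E)) (L : seq (seq (R * E))).

Let cT : compact [set: T] := @state_space_compact E R s cK.

(** The barycenter of [mu] restricted to [A], not divided by the mass of [A]: it lies in the cone of
    states, with mass [mu A], and is additive in [A]. *)
Definition mean (A : set (borel T)) : X :=
  fun a => \int[mu]_(x in A) (\val x : X) a.

Lemma eval_integrable a A : measurable A ->
  mu.-integrable A (EFin \o (fun x : T => (\val x : X) a)).
Proof.
move=> mA; apply: (@continuous_integrable R T mu (fun x => (\val x : X) a)) =>
  //.
exact: eval_state_continuous.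
Qed.

Lemma lincomb_integrable l A : measurable A ->
  mu.-integrable A (EFin \o (fun x : T => lincomb l (\val x : X))).
Proof.
move=> mA.
apply: (@continuous_integrable R T mu (fun x => lincomb l (\val x : X))) => //.
exact: lincomb_state_continuous.
Qed.

Lemma max_lincomb_integrable L A : measurable A ->
  mu.-integrable A (EFin \o (fun x : T => max_lincomb L (\val x : X))).
Proof.
move=> mA.
apply: (@continuous_integrable R T mu
  (fun x => max_lincomb L (\val x : X))) => //.
exact: max_lincomb_state_continuous.
Qed.

Lemma mean_state_cone A : measurable A -> state_cone E R (mean A).
Proof.
move=> mA.
have xP (x : T) : states E R (\val x : X) by exact/set_mem/valP.
split=> [a|a b c abc].
  by apply: Rintegral_ge0 => x _; have [/(_ a)/andP[]] := xP x.
rewrite /mean -RintegralD//; try exact: eval_integrable.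
by apply: eq_Rintegral => x _; have [_ _ /(_ _ _ _ abc)] := xP x.
Qed.

Lemma mean_pone A : measurable A -> mean A pone = fine (mu A).
Proof.
move=> mA; rewrite -[RHS]mul1r -Rintegral_cst//.
by apply: eq_Rintegral => x _; have [_ ->] : states E R (\val x : X)
  by exact/set_mem/valP.
Qed.

Lemma mean_lincomb l A : measurable A ->
  lincomb l (mean A) = \int[mu]_(x in A) lincomb l (\val x : X).
Proof.
move=> mA; elim: l => [|i l IH].
  rewrite /lincomb big_nil.
  transitivity (\int[mu]_(x in A) (0 : R));
    first by rewrite Rintegral_cst// mul0r.
  by apply: eq_Rintegral => x _; rewrite big_nil.
rewrite {1}/lincomb big_cons -/(lincomb l _) IH /mean -RintegralZl//;
  last first.
  exact: eval_integrable.
rewrite -RintegralD//.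
- by apply: eq_Rintegral => x _; rewrite /lincomb big_cons.
- rewrite (_ : EFin \o _ = EFin \o (fun x : T => lincomb [:: i] (\val x : X))).
    exact: lincomb_integrable.
  by apply/funext => x /=; rewrite /lincomb big_seq1.
- exact: lincomb_integrable.
Qed.

Let Rintegral_split (f : T -> R) A B : measurable A -> measurable B ->
  mu.-integrable A (EFin \o f) ->
  \int[mu]_(x in A) f x =
  \int[mu]_(x in A `&` B) f x + \int[mu]_(x in A `\` B) f x.
Proof.
move=> mA mB fA; rewrite -Rintegral_setU ?setUIDK//.
- exact: measurableI.
- exact: measurableD.
- by apply/eqP; rewrite setDE setIACA setICr setI0.
Qed.

Lemma mean_split A B : measurable A -> measurable B ->
  mean A = mean (A `&` B) + mean (A `\` B).
Proof.
move=> mA mB; apply/funext => a; rewrite ptws_addE.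
by apply: Rintegral_split => //; exact: eval_integrable.
Qed.

Lemma max_lincomb_ge0 L (p : X) : 0 <= max_lincomb L p.
Proof. by elim: L => //= l L IH; rewrite le_max IH orbT. Qed.

(** Cutting [A] along the set [B] where [l] realizes the maximum decomposes the mean of [A], and the
    envelope dominates the value of each decomposition. *)
Lemma Rintegral_max_lincomb_le L A : measurable A ->
  \int[mu]_(x in A) max_lincomb L (\val x : X) <= envelope L (mean A).
Proof.
elim: L A => [|l L IH] A mA; first by rewrite Rintegral_cst// mul0r.
pose B : set (borel T) :=
  [set x | max_lincomb L (\val x : X) <= lincomb l (\val x : X)].
have mB : measurable B.
  rewrite -[B]setTI; apply: measurable_fun_le => //.
    by apply: continuous_borel; exact: max_lincomb_state_continuous.
  by apply: continuous_borel; exact: lincomb_state_continuous.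
have mAB : measurable (A `&` B) by exact: measurableI.
have mAnB : measurable (A `\` B) by exact: measurableD.
rewrite (Rintegral_split mA mB (max_lincomb_integrable (l :: L) mA)).
rewrite (mean_split mA mB).
apply: le_trans (envelope_ge _ _ (mean_state_cone mAB) (mean_state_cone mAnB)).
apply: lerD.
  rewrite mean_lincomb//; rewrite le_eqVlt; apply/orP; left; apply/eqP.
  by apply: eq_Rintegral => x /set_mem[_ /= xB]; rewrite max_l.
apply: le_trans (IH _ mAnB); rewrite le_eqVlt; apply/orP; left; apply/eqP.
apply: eq_Rintegral => x /set_mem[_ /negP]; rewrite -ltNge => /ltW xB.
by rewrite /= max_r.
Qed.

Hypothesis rdp : riesz_decomposition E R.
Hypothesis cX : compact (extreme_points (states E R)).

(** Near an extreme state [x], the normalized mean of a small piece is a state close to [x]. By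
    semicontinuity its envelope barely exceeds that of [x], which is at most the maximum at [x], and
    that maximum is nearly constant on the piece. Additivity of the envelope sums up the pieces. *)
Lemma envelope_mean_le L (e : R) : 0 < e ->
  envelope L (mean (extreme_states s)) <=
  \int[mu]_(x in extreme_states s) max_lincomb L (\val x : X) + e.
Proof.
move=> e0; have K0 : states E R !=set0 by exists (\val s); exact/set_mem/valP.
(* The error is proportional to the mass, so that errors add up to at most [e]. [P] asks for [good]
   on all measurable subsets of a cover, which lets two covers be combined by cutting along one of
   them. *)
pose good A := envelope L (mean A) <=
  \int[mu]_(x in A) max_lincomb L (\val x : X) + e * fine (mu A).
pose P (A : set T) := exists A' : set (borel T), [/\ measurable A', A `<=` A' &
  forall B, measurable B -> B `<=` A' -> B `<=` extreme_states s -> good B].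
have clX := @extreme_states_closed E R s cX.
have mX : measurable (extreme_states s : set (borel T)) by exact: closed_borel.
have fmu A B : measurable A -> measurable B ->
    fine (mu A) = fine (mu (A `&` B)) + fine (mu (A `\` B)).
  move=> mA mB; rewrite -!mean_pone//; try exact: measurableI.
    by rewrite (mean_split mA mB).
  exact: measurableD.
have good0 : good set0.
  have m0 : mean set0 = 0.
    by apply/funext => a; rewrite /mean Rintegral_set0.
  rewrite /good m0 Rintegral_set0 measure0 mulr0 addr0.
  have [B _ /(_ 0 (state_cone0 _ _))] := envelope_bounded L.
  by rewrite ptws_zeroE mulr0.
suff : P (extreme_states s).
  move=> [A' [mA' XA' /(_ _ mX XA' (@subset_refl _ _))]] /le_trans; apply.
  rewrite lerD2l -[leRHS]mulr1 ler_wpM2l ?(ltW e0)//.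
  have := probability_le1 mu mX; rewrite -(fineK (fin_num_measure mu _ mX)).
  by rewrite lee_fin.
apply: (@compact_ind T _ P).
- exact: (subclosed_compact clX cT).
- exists set0; split=> // B mB; rewrite subset0 => -> _; exact: good0.
- move=> A B [A' [mA' AA' gA]] [B' [mB' BB' gB]].
  exists (A' `|` B'); split; [exact: measurableU|exact: setUSS|].
  move=> C mC CAB CX; rewrite /good (mean_split mC mA').
  have mCA : measurable (C `&` A') by exact: measurableI.
  have mCnA : measurable (C `\` A') by exact: measurableD.
  rewrite envelopeD//; try exact: mean_state_cone.
  rewrite (Rintegral_split mC mA' (max_lincomb_integrable L mC)) (fmu _ _ mC
    mA').
  have : good (C `&` A') by apply: gA => // x [// /CX].
  have : good (C `\` A').
    by apply: gB => // x [Cx nA]; [case: (CAB _ Cx)|exact: CX].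
  by rewrite /good mulrDr => *; lra.
- move=> A B AB [B' [mB' BB' gB]]; exists B'; split=> //.
  exact: subset_trans BB'.
move=> x Xx.
have e2 : 0 < e / 2 by rewrite divr_gt0.
have [xC x1] := (statesP _).1 Xx.1.
have xC1 : bounded_state_cone (\val x) by split=> //; rewrite x1.
have [N' N'x hull] := ptws_nbhs_hull (envelope_usc L K0 cK e2 xC1).
have /cvgrPdist_lt/(_ _ e2) Mx := @max_lincomb_state_continuous E R s L x.
have /= N'x' := @state_val_continuous E R s x _ N'x.
have : nbhs x [set y : T | N' (\val y) /\
    max_lincomb L (\val x : X) < max_lincomb L (\val y : X) + e / 2].
  apply: (@filterS2 T (nbhs x) _ _ _ _ _ N'x' Mx) => y /= N'y;
    rewrite ltr_distlC => /andP[h1 h2].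
  by split=> //; lra.
rewrite nbhsE => -[ O [oO Ox] OP]; exists O.
  by exists O.
exists O; split=> //; first exact: open_borel.
move=> B mB BO BX; have BC := mean_state_cone mB.
have muB := mean_pone mB.
(* A piece of mass zero cannot be normalized; its mean is [0]. *)
have [m0|m0] := eqVneq (mean B pone) 0.
  rewrite /good -muB m0 mulr0 addr0 (state_cone_eq0 BC m0).
  have [M _ /(_ 0 (state_cone0 _ _))] := envelope_bounded L.
  rewrite ptws_zeroE mulr0 => /le_trans; apply.
  by apply: Rintegral_ge0 => y _; exact: max_lincomb_ge0.
have mB0 : 0 < mean B pone by rewrite lt_neqAle eq_sym m0; exact: BC.1.
set r := (mean B pone)^-1 *: mean B.
have Kr : states E R r by exact: state_cone_normalize.
have [rC r1] := (statesP r).1 Kr.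
have Br : mean B = mean B pone *: r by rewrite scalerA mulfV// scale1r.
(* Averaging preserves coordinatewise bounds, so the normalized mean [r] stays in the neighbourhood
   of [x] given by semicontinuity. *)
have : bounded_state_cone r -> envelope L r < envelope L (\val x) + e / 2.
  apply: hull => a u v uv.
  have cst_int (c : R) : mu.-integrable B (EFin \o (fun _ : T => c)).
    by apply: (@continuous_integrable R T mu (cst c)) => //;
      exact: cst_continuous.
  have uvB (y : T) : B y -> u <= (\val y : X) a <= v.
    by move=> /BO/OP[/= /uv].
  rewrite /r ptws_scaleE mulrC ler_pdivlMr// ler_pdivrMr// muB.
  rewrite -!Rintegral_cst//; apply/andP; split; apply: le_Rintegral => //.
  - exact: eval_integrable.
  - by move=> y /uvB /andP[].
  - exact: eval_integrable.
  - by move=> y /uvB /andP[].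
have r11 : bounded_state_cone r by split=> //; rewrite r1.
move=> /(_ r11) Nr.
have ex : envelope L (\val x) <= max_lincomb L (\val x : X).
  by have := envelope_extreme L Xx ler01; rewrite scale1r mul1r.
have : (max_lincomb L (\val x : X) - e / 2) * fine (mu B) <=
    \int[mu]_(y in B) max_lincomb L (\val y : X).
  rewrite -Rintegral_cst//; apply: le_Rintegral => //.
  - by apply: (@continuous_integrable R T mu (cst _)) => //;
    exact: cst_continuous.
  - exact: max_lincomb_integrable.
  - by move=> y /BO/OP[_ /=]; lra.
have := envelopeZ_le L mB0 rC; rewrite -Br -muB /good -muB.
have : mean B pone * envelope L r <=
    mean B pone * (max_lincomb L (\val x : X) + e / 2).
  by rewrite ler_pM2l//; lra.
by rewrite mulrDr mulrBl => *; lra.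
Qed.

End Barycenter.

(** * Uniqueness *)

Section LatticeOfDifferences.
Variables (E : effectAlgebraType) (R : realType) (s : states E R).
Local Notation X := (ptws_space E R).
Local Notation T := (state_space s).
Implicit Types (p : X) (l : seq (R * E)) (L : seq (seq (R * E))).

Lemma max_lincomb_cat L L' p :
  max_lincomb (L ++ L') p = Num.max (max_lincomb L p) (max_lincomb L' p).
Proof.
elim: L => [|l L IH] /=; last by rewrite IH maxA.
by rewrite max_r//; exact: max_lincomb_ge0.
Qed.

Lemma lincomb_cat l l' p : lincomb (l ++ l') p = lincomb l p + lincomb l' p.
Proof. by rewrite /lincomb big_cat. Qed.

Lemma max_lincomb_add1 l L : exists M, forall p,
  max_lincomb M p = Num.max 0 (lincomb l p + max_lincomb L p).
Proof.
elim: L => [|l' L [M ME]].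
  by exists [:: l] => p /=; rewrite addr0 maxC.
exists ((l ++ l') :: M) => p /=; rewrite ME lincomb_cat [in RHS]addr_maxr.
by rewrite maxCA.
Qed.

(** Addition distributes over maxima. The extra [0] contributed by [max_lincomb_add1] is absorbed,
    since a sum of two such maxima is nonnegative. *)
Lemma max_lincombD L L' : exists M, forall p,
  max_lincomb M p = max_lincomb L p + max_lincomb L' p.
Proof.
elim: L => [|l L [M ME]]; first by exists L' => p /=; rewrite add0r.
have [M' M'E] := max_lincomb_add1 l L'; exists (M' ++ M) => p.
rewrite max_lincomb_cat ME M'E /= [in RHS]addr_maxl -maxA max_r// le_max.
by apply/orP; right; apply: addr_ge0; exact: max_lincomb_ge0.
Qed.

Definition max_difference (h : T -> R) : Prop :=
  exists L L', forall x : T,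
    h x = max_lincomb L (\val x : X) - max_lincomb L' (\val x : X).

Lemma max_differenceN h : max_difference h -> max_difference (fun x => - h x).
Proof. by move=> [L [L' hE]]; exists L', L => x; rewrite hE opprB. Qed.

(** The maximum of [a - b] and [c - d] is the maximum of [a + d] and [c + b], minus [b + d]. *)
Lemma max_difference_max g h : max_difference g -> max_difference h ->
  max_difference (fun x => Num.max (g x) (h x)).
Proof.
move=> [L [L' gE]] [M [M' hE]].
have [N NE] := max_lincombD L M'; have [N' N'E] := max_lincombD M L'.
have [K KE] := max_lincombD L' M'.
exists (N ++ N'), K => x; rewrite max_lincomb_cat NE N'E KE addr_maxl gE hE.
by congr Num.max; lra.
Qed.

Lemma max_difference_min g h : max_difference g -> max_difference h ->
  max_difference (fun x => Num.min (g x) (h x)).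
Proof.
move=> mg mh.
have := max_differenceN (max_difference_max (max_differenceN mg)
  (max_differenceN mh)).
by congr max_difference; apply/funext => x; rewrite oppr_max !opprK.
Qed.

Lemma max_difference_lincomb l :
  max_difference (fun x : T => lincomb l (\val x : X)).
Proof.
exists [:: l], [:: [seq (- i.1, i.2) | i <- l]] => x /=.
have -> : lincomb [seq (- i.1, i.2) | i <- l] (\val x : X) =
    - lincomb l (\val x : X).
  by rewrite /lincomb big_map -sumrN; apply: eq_bigr => i _; rewrite mulNr.
have /orP[h|h] := le_total 0 (lincomb l (\val x : X)).
  by rewrite max_l// max_r ?subr0// oppr_le0.
by rewrite max_r// max_l ?oppr_ge0// sub0r opprK.
Qed.

(** States are 1 at [pone], so constants are multiples of an evaluation. *)
Lemma lincomb_affine a (u v : R) :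
  (fun x : T => u * (\val x : X) a + v) =
  (fun x : T => lincomb [:: (u, a); (v, pone)] (\val x : X)).
Proof.
apply/funext => x; rewrite /lincomb !big_cons big_nil.
have [_ ->] := (statesP _).1 (set_mem (valP x)).
by rewrite mulr1 addr0.
Qed.

Lemma max_difference_affine a (u v : R) :
  max_difference (fun x : T => u * (\val x : X) a + v).
Proof. by rewrite lincomb_affine; exact: max_difference_lincomb. Qed.

Lemma max_difference_separation (x y : T) : x <> y ->
  exists h : T -> R, [/\ max_difference h, forall z, 0 <= h z <= 1,
    \forall z \near x, h z = 1 & \forall z \near y, h z = 0].
Proof.
move=> xy.
have [a xya] : exists a, (\val x : X) a != (\val y : X) a.
  apply: contrapT => H; apply: xy; apply: val_inj; apply/funext => a.
  by apply: contrapT => /eqP xya; apply: H; exists a.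
have d0 : (\val x : X) a - (\val y : X) a != 0 by rewrite subr_eq0.
(* The affine function [g] takes the values [2] at [x] and [-1] at [y], overshooting [[0, 1]] on
   both sides, so its truncation is constant near each point. *)
pose u : R := 3 / ((\val x : X) a - (\val y : X) a).
pose g (z : T) := u * (\val z : X) a + (2 - u * (\val x : X) a).
have gx : g x = 2 by rewrite /g; lra.
have gy : g y = - 1.
  have : u * ((\val x : X) a - (\val y : X) a) = 3 by rewrite divfK.
  by rewrite mulrBr /g => ?; lra.
have cg : continuous (g : T -> R^o).
  by rewrite /g lincomb_affine; exact: lincomb_state_continuous.
exists (fun z => Num.min 1 (Num.max 0 (g z))); split.
- apply: max_difference_min; last apply: max_difference_max.
  + have := max_difference_affine a 0 1; congr max_difference.
    by apply/funext => z; rewrite mul0r add0r.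
  + have := max_difference_affine a 0 0; congr max_difference.
    by apply/funext => z; rewrite mul0r add0r.
  + exact: max_difference_affine.
- move=> z; rewrite le_min ler01 ge_min lexx/= andbT.
  by rewrite le_max lexx.
- have /cvgrPdist_lt/(_ _ ltr01) := cg x; apply: filterS => z.
  rewrite gx ltr_distlC => /andP[h1 h2]; rewrite min_l// le_max.
  by apply/orP; right; lra.
- have /cvgrPdist_lt/(_ _ ltr01) := cg y; apply: filterS => z.
  rewrite gy ltr_distlC => /andP[h1 h2].
  by rewrite [Num.max _ _]max_l ?min_r//; lra.
Qed.

(** Two compactness arguments: for a fixed point of [D], finitely many separating functions are
    joined by maxima over [C]; the results are then combined by minima over [D]. *)
Lemma max_difference_urysohn (C D : set T) : compact C -> compact D ->
  C `&` D = set0 ->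
  exists h : T -> R, [/\ max_difference h, forall z, 0 <= h z <= 1,
    forall z, C z -> h z = 1 & forall z, D z -> h z = 0].
Proof.
move=> cC cD CD.
have cst_diff (c : R) : max_difference (fun=> c).
  have := max_difference_affine pone 0 c; congr max_difference.
  by apply/funext => z; rewrite mul0r add0r.
have near_y (y : T) : D y -> exists h : T -> R, [/\ max_difference h,
    forall z, 0 <= h z <= 1, forall z, C z -> h z = 1 &
    \forall z \near y, h z = 0].
  move=> Dy; pose P A := exists h : T -> R, [/\ max_difference h,
    forall z, 0 <= h z <= 1, forall z, A z -> h z = 1 &
    \forall z \near y, h z = 0].
  apply: (@compact_ind T C P) => //.
  - exists (fun=> 0); split=> //; first by move=> z; rewrite lexx ler01.
    exact: filterE.
  - move=> A B [g [dg g01 gA gy]] [h [dh h01 hB hy]].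
    exists (fun z => Num.max (g z) (h z)); split.
    + exact: max_difference_max.
    + move=> z; have /andP[g0 g1] := g01 z; have /andP[h0 h1] := h01 z.
      by rewrite le_max g0/= ge_max g1.
    + move=> z [/gA gz|/hB hz].
        by rewrite gz max_l//; have /andP[] := h01 z.
      by rewrite hz max_r//; have /andP[] := g01 z.
    + by apply: filterS2 gy hy => z -> ->; rewrite maxxx.
  - by move=> A B AB [h [dh h01 hB hy]]; exists h; split=> // z /AB /hB.
  - move=> x Cx; have xy : x <> y.
      by move=> xy; have : (C `&` D) x; [split=> //; rewrite xy|rewrite CD].
    have [h [dh h01 hx hy]] := max_difference_separation xy.
    by exists [set z | h z = 1] => //; exists h.
pose P B := exists h : T -> R, [/\ max_difference h, forall z, 0 <= h z <= 1,
  forall z, C z -> h z = 1 & forall z, B z -> h z = 0].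
apply: (@compact_ind T D P) => //.
- by exists (fun=> 1); split=> // z; rewrite lexx ler01.
- move=> A B [g [dg g01 gC gA]] [h [dh h01 hC hB]].
  exists (fun z => Num.min (g z) (h z)); split.
  + exact: max_difference_min.
  + move=> z; have /andP[g0 g1] := g01 z; have /andP[h0 h1] := h01 z.
    by rewrite le_min g0 h0/= ge_min g1.
  + by move=> z Cz; rewrite gC// hC// minxx.
  + move=> z [/gA gz|/hB hz].
      by rewrite gz min_l//; have /andP[] := h01 z.
    by rewrite hz min_r//; have /andP[] := g01 z.
- by move=> A B AB [h [dh h01 hC hB]]; exists h; split=> // z /AB /hB.
- move=> y /near_y [h [dh h01 hC hy]]; exists [set z | h z = 0] => //.
  by exists h.
Qed.

End LatticeOfDifferences.

(** * Comparison of two regular representing measures *)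

Section Uniqueness.
Variables (E : effectAlgebraType) (R : realType) (s : states E R).
Local Notation X := (ptws_space E R).
Local Notation T := (state_space s).
Hypothesis cK : compact (states E R).
Hypothesis cX : compact (extreme_points (states E R)).
Hypothesis rdp : riesz_decomposition E R.

Local Notation Xe := (extreme_states s : set (borel T)).

Let mX : measurable (extreme_states s : set (borel T)).
Proof. by apply: closed_borel; exact: (@extreme_states_closed E R s cX). Qed.

Lemma represents_mean (mu : probability (borel T) R) : represents mu ->
  mean mu (extreme_states s) = \val s.
Proof.
move=> rmu; apply/funext => a; rewrite /mean /Rintegral.
by have := rmu a; rewrite /evaluation => <-.
Qed.

(** Representation at [pone] says that [mu] is carried by the extreme states. *)
Lemma represents_extreme_states (mu : probability (borel T) R) :
  represents mu -> mu (extreme_states s) = 1%E.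
Proof.
move=> /represents_mean rmu; have := mean_pone mu mX.
rewrite rmu; have [_ ->] := (statesP _).1 (set_mem (valP s)) => e.
by rewrite -(fineK (fin_num_measure mu _ mX)) -e.
Qed.

(** The right-hand side depends on [s] alone, so all representing measures integrate these maxima
    alike. *)
Lemma represents_max_lincomb (mu : probability (borel T) R) L :
  represents mu ->
  \int[mu]_(x in extreme_states s) max_lincomb L (\val x : X) =
  envelope L (\val s).
Proof.
move=> rmu; rewrite -(represents_mean rmu); apply/eqP.
rewrite eq_le Rintegral_max_lincomb_le//=.
by apply/ler_addgt0Pr => e e0; exact: envelope_mean_le.
Qed.

Lemma represents_max_difference (mu nu : probability (borel T) R)
    (h : T -> R) :
  represents mu -> represents nu -> max_difference h ->
  \int[mu]_(x in extreme_states s) h x =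
  \int[nu]_(x in extreme_states s) h x.
Proof.
move=> rmu rnu [L [L' hE]].
have I (m : probability (borel T) R) : represents m ->
    \int[m]_(x in extreme_states s) h x =
    envelope L (\val s) - envelope L' (\val s).
  move=> rm; rewrite -!(represents_max_lincomb _ rm) -RintegralB//.
  - by apply: eq_Rintegral => x _; rewrite hE.
  - exact: max_lincomb_integrable.
  - exact: max_lincomb_integrable.
by rewrite I// I.
Qed.

(** For open [U] around [C], a function [h] in the lattice, equal to 1 on [C] and 0 off [U], has the
    same integral for both measures, which gives [mu C <= nu U]. Outer regularity of [nu]
    concludes. *)
Lemma represents_closed_le (mu nu : probability (borel T) R) (C : set T) :
  represents mu -> represents nu -> regular_measure nu -> closed C ->
  (mu C <= nu C)%E.
Proof.
move=> rmu rnu reg clC.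
have cT : compact [set: T] := @state_space_compact E R s cK.
have mC : measurable (C : set (borel T)) by exact: closed_borel.
have [-> _] := reg C mC; apply: le_ereal_inf_tmp => _ [U [oU CU] <-].
have mU : measurable (U : set (borel T)) by exact: open_borel.
have [|||h [dh h01 hC hU]] := @max_difference_urysohn E R s C (~` U).
- exact: subclosed_compact clC cT _.
- by apply: subclosed_compact cT _ => //; exact: open_closedC.
- by rewrite -subset0 => z [/CU].
have hI (m : probability (borel T) R) A : measurable A ->
    m.-integrable A (EFin \o h).
  move=> mA; have [L [L' hE]] := dh.
  rewrite (_ : h = fun x => max_lincomb L (\val x : X) -
    max_lincomb L' (\val x : X)); last by apply/funext.
  apply: (@integrableB _ _ _ m A mA
    (EFin \o (fun x : T => max_lincomb L (\val x : X)))
    (EFin \o (fun x : T => max_lincomb L' (\val x : X)))).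
    exact: max_lincomb_integrable.
  exact: max_lincomb_integrable.
have oneI (m : probability (borel T) R) (A : set (borel T)) : measurable A ->
    m.-integrable A (EFin \o (fun=> 1%R : R)).
  move=> mA; apply: (@continuous_integrable R T m (cst 1)) => //.
  exact: cst_continuous.
have zeroI (m : probability (borel T) R) (A : set (borel T)) : measurable A ->
    m.-integrable A (EFin \o (fun=> 0%R : R)).
  move=> mA; apply: (@continuous_integrable R T m (cst 0)) => //.
  exact: cst_continuous.
have splitX (m : probability (borel T) R) (A : set (borel T)) : measurable A ->
    \int[m]_(x in extreme_states s) h x =
    \int[m]_(x in Xe `&` A) h x +
    \int[m]_(x in Xe `\` A) h x.
  move=> mA; rewrite -Rintegral_setU ?setUIDK//.
  - exact: measurableI.
  - exact: measurableD.
  - exact: hI.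
  - by apply/eqP; rewrite setDE setIACA setICr setI0.
have mXC := measurableI _ _ mX mC; have mXnC := measurableD mX mC.
have mXU := measurableI _ _ mX mU; have mXnU := measurableD mX mU.
have le1 : fine (mu (Xe `&` C)) <=
    \int[mu]_(x in extreme_states s) h x.
  rewrite (splitX mu _ mC) -[leLHS]addr0 -[fine _]mul1r -Rintegral_cst//.
  apply: lerD; last by apply: Rintegral_ge0 => x _; have /andP[] := h01 x.
  apply: le_Rintegral => //; [exact: oneI|exact: hI|].
  by move=> x [_ /hC ->].
have le2 : \int[nu]_(x in extreme_states s) h x <=
    fine (nu (Xe `&` U)).
  rewrite (splitX nu _ mU) -[leRHS]addr0 -[fine _]mul1r -Rintegral_cst//.
  apply: lerD.
    apply: le_Rintegral => //; [exact: hI|exact: oneI|].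
    by move=> x _; have /andP[] := h01 x.
  rewrite -[leRHS](mul0r (fine (nu (Xe `\` U)))) -Rintegral_cst//.
  apply: le_Rintegral => //; [exact: hI|exact: zeroI|].
  by move=> x [_ /hU ->].
(* Integrals run over the extreme states, whose complement is null for [mu]. *)
have -> : mu C = mu (Xe `&` C).
  have mCX := measurableD mC mX; rewrite setIC.
  rewrite -[in LHS](setUIDK C Xe) measureU//; last first.
  - by rewrite setDE setIACA setICr setI0.
  - exact: measurableI.
  rewrite [X in (_ + X)%E](_ : _ = 0%E) ?adde0//; apply/eqP.
  rewrite eq_le measure_ge0 andbT.
  have <- : mu (~` Xe) = 0%E.
    by rewrite probability_setC// represents_extreme_states// subee.
  by apply: le_measure; rewrite ?inE//; exact: measurableC.
apply: (@le_trans _ _ (nu (Xe `&` U))); last first.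
  by apply: le_measure; rewrite ?inE// => x [].
rewrite -(fineK (fin_num_measure mu _ mXC)) -(fineK (fin_num_measure nu _ mXU)).
rewrite lee_fin; apply: le_trans le1 _.
by rewrite (represents_max_difference rmu rnu dh).
Qed.

Lemma represents_unique (mu nu : probability (borel T) R) :
  regular_measure mu -> represents mu -> regular_measure nu -> represents nu ->
  forall Y : set (borel T), measurable Y -> nu Y = mu Y.
Proof.
move=> regmu rmu regnu rnu Y mY.
have [_ ->] := regnu Y mY; have [_ ->] := regmu Y mY.
congr ereal_sup; apply/seteqP; split=> _ [C [cC CY] <-]; exists C => //;
  by apply/eqP; rewrite eq_le !represents_closed_le.
Qed.

End Uniqueness.

(** * Bauer's minimum principle *)

Section ExtremeMinimizers.
Variables (E : effectAlgebraType) (R : realType).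
Local Notation X := (ptws_space E R).
Local Notation K := (states E R).
Hypothesis cK : compact K.
Implicit Types (F G : set X) (l : seq (R * E)).

Definition compact_face F : Prop :=
  [/\ F !=set0, compact F, F `<=` K &
      forall (t : R) (y z : X), K y -> K z -> 0 < t < 1 ->
        F (t *: y + (1 - t) *: z) -> F y /\ F z].

Definition minimizers F l : set X :=
  [set x | F x /\ forall y, F y -> lincomb l x <= lincomb l y].

(** A linear functional can attain its minimum at a proper convex combination only if it attains it
    at both ends. *)
Lemma minimizers_face F l : compact_face F -> compact_face (minimizers F l).
Proof.
move=> [F0 cF FK faceF].
have [x Fx xmin] : exists2 x, F x & forall y, F y -> lincomb l x <= lincomb l y.
  have cl : {within F, continuous (lincomb l : X -> R^o)}.
    by apply: continuous_subspaceT; exact: lincomb_continuous.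
  have [x Fx xmin] := compact_EVT_min F0 cF cl.
  by exists x; [exact: set_mem|move=> y Fy; apply: xmin; exact: mem_set].
split.
- by exists x.
- apply: (subclosed_compact _ cF) => [|y []//].
  rewrite (_ : minimizers F l = F `&` lincomb l @^-1` [set r | r <= lincomb l
    x]).
    apply: closedI; first exact: compact_closed (@ptws_space_hausdorff E R) cF.
    apply: (@closed_comp X R^o); last exact: closed_le.
    by move=> y _; exact: lincomb_continuous.
  apply/seteqP; split=> y [Fy /= ymin]; split=> //; first exact: ymin.
  by move=> z Fz; apply: le_trans ymin (xmin z Fz).
- by move=> y [/FK].
move=> t y z Ky Kz t01 [Fw wmin]; have [Fy Fz] := faceF _ _ _ Ky Kz t01 Fw.
have /andP[t0 t1] := t01.
have wE : lincomb l (t *: y + (1 - t) *: z) =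
    t * lincomb l y + (1 - t) * lincomb l z by rewrite lincombD !lincombZ.
have yz : lincomb l y = lincomb l z.
  have := wmin _ Fy; have := wmin _ Fz; rewrite wE => h1 h2.
  apply/eqP; rewrite eq_le; apply/andP; split.
    by rewrite -(ler_pM2l t0); lra.
  by rewrite -(@ler_pM2l _ (1 - t)) ?subr_gt0//; lra.
have wy : lincomb l (t *: y + (1 - t) *: z) = lincomb l y by rewrite wE yz; lra.
by split; split=> // u Fu; rewrite -?yz -wy; exact: wmin.
Qed.

(** Provides lower bounds of chains for Zorn's lemma; compactness keeps the intersection
    nonempty. *)
Lemma face_bigcap (A : set (set X)) : A !=set0 ->
  (forall F, A F -> compact_face F) ->
  (forall F G, A F -> A G -> F `<=` G \/ G `<=` F) ->
  compact_face (\bigcap_(F in A) F).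
Proof.
move=> [F0 AF0] faceA tot.
have hX := @ptws_space_hausdorff E R.
have clA F : A F -> closed F.
  by move=> /faceA[_ cF _ _]; exact: compact_closed hX cF.
split.
- have FF : Filter (filter_from A id).
    apply: filter_from_filter; first by exists F0.
    move=> F G AF AG; have [FG|GF] := tot _ _ AF AG.
      by exists F => // x Fx; split=> //; exact: FG.
    by exists G => // x Gx; split=> //; exact: GF.
  have PF : ProperFilter (filter_from A id).
    by apply: filter_from_proper => F /faceA[].
  have [_ cF0 _ _] := faceA _ AF0.
  have FF0 : filter_from A id F0 by exists F0.
  have [p [_ clp]] := cF0 _ PF FF0.
  exists p => F AF; apply: (clA _ AF) => B pB.
  by apply: (clp F B) => //; exists F.
- have [_ cF0 _ _] := faceA _ AF0.
  apply: (subclosed_compact _ cF0); last exact: bigcap_inf.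
  by apply: closed_bigI => F; exact: clA.
- by have [_ _ F0K _] := faceA _ AF0; move=> x /(_ _ AF0) /F0K.
move=> t y z Ky Kz t01 yz; split=> F AF; have [_ _ _ faceF] := faceA _ AF;
  by have [] := faceF _ _ _ Ky Kz t01 (yz _ AF).
Qed.

(** As in the Krein-Milman theorem: a minimal compact face equals its own face of minimizers for
    each evaluation, so every evaluation is constant on it and it is a single point, which is
    extreme. *)
Lemma face_extreme_point F : compact_face F ->
  exists2 e, F e & extreme_points K e.
Proof.
move=> faceF.
pose P G := compact_face G /\ G `<=` F.
pose D := {G | P G}.
have d0 : D by exists F; split.
pose r (G H : D) := `[< sval H `<=` sval G >].
have [| | |G Gmin] := @ZL_preorder D d0 r.
- by move=> G; exact/asboolP.
- move=> G H I /asboolP HG /asboolP IH; apply/asboolP.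
  exact: subset_trans HG.
- move=> A tot.
  have [[G0 AG0]|A0] := pselect (A !=set0); last first.
    by exists d0 => G AG; case: A0; exists G.
  pose B := [set sval G | G in A].
  have faceB : compact_face (\bigcap_(G in B) G).
    apply: face_bigcap.
    - by exists (sval G0), G0.
    - by move=> _ [G _ <-]; exact: (svalP G).1.
    - by move=> _ _ [G AG <-] [H AH <-];
      have [/asboolP|/asboolP] := tot _ _ AG AH;
        [right|left].
  have BF : \bigcap_(G in B) G `<=` F.
    move=> x Bx; apply: (svalP G0).2; apply: Bx; by exists G0.
  exists (exist P _ (conj faceB BF)) => G AG; apply/asboolP => x /=; apply.
  by exists G.
have [[[e Ge] cG GK faceG] GF] := svalP G.
have sub x y : sval G x -> sval G y -> forall a, x a <= y a.
  move=> Gx Gy a.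
  have fm := minimizers_face [:: (1, a)] (svalP G).1.
  have mF : minimizers (sval G) [:: (1, a)] `<=` F by move=> z [/GF].
  have /Gmin/asboolP/(_ x Gx) : r G (exist P _ (conj fm mF)).
    by apply/asboolP => z [].
  by move=> [_ /(_ _ Gy)]; rewrite /lincomb !big_seq1 !mul1r.
have one x : sval G x -> x = e.
  by move=> Gx; apply/funext => a; apply/eqP; rewrite eq_le !sub.
exists e; first exact: GF Ge.
split; first exact: GK Ge.
move=> t y z Ky Kz t01 eE; have := Ge;
  rewrite {1}eE => /(faceG _ _ _ Ky Kz t01).
by move=> [/one -> /one ->].
Qed.

Lemma bauer_minimum l : K !=set0 ->
  exists2 e, extreme_points K e & forall x, K x -> lincomb l e <= lincomb l x.
Proof.
move=> K0; have faceK : compact_face K by split.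
have [e [Ke emin] exte] := face_extreme_point (minimizers_face l faceK).
by exists e.
Qed.

End ExtremeMinimizers.

(** * Existence *)

Section BoundedFunctions.
Variables (R : realType) (T : Type).

Definition bounded_real_pred : {pred T -> R^o} :=
  fun f => `[< exists M : R, forall x, `|f x| <= M >].

Lemma bounded_real_submod : GRing.submod_closed bounded_real_pred.
Proof.
split=> [|t f g /asboolP[M fM] /asboolP[N gN]]; apply/asboolP.
  by exists 0 => x; rewrite normr0.
exists (`|t| * M + N) => x; apply: le_trans (ler_normD _ _) _.
by apply: lerD => //; rewrite normrM ler_wpM2l.
Qed.

HB.instance Definition _ :=
  GRing.isSubmodClosed.Build R (T -> R^o) bounded_real_pred bounded_real_submod.

(** [hahn_banach] speaks of a whole module, hence bounded functions are packaged as one. *)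
Record bounded_function := BoundedFunction {
  bounded_function_val :> T -> R^o;
  _ : bounded_function_val \in bounded_real_pred }.

HB.instance Definition _ := [isSub for bounded_function_val].
HB.instance Definition _ := [Choice of bounded_function by <:].
HB.instance Definition _ :=
  [SubChoice_isSubLmodule of bounded_function by <:].

End BoundedFunctions.

(** The sum counts the integers from 1 to [n] that do not exceed [z]. *)
Lemma staircase_sum (R : realType) (z : R) (n : nat) : 0 <= z ->
  [/\ \sum_(k < n) (k.+1%:R <= z)%R%:R <= z,
      z <= n%:R -> z <= \sum_(k < n) (k.+1%:R <= z)%R%:R + 1 &
      n%:R <= z -> \sum_(k < n) (k.+1%:R <= z)%R%:R = n%:R :> R].
Proof.
move=> z0; elim: n => [|n [IH1 IH2 IH3]].
  by rewrite big_ord0; split=> // *; lra.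
rewrite big_ord_recr/= [n.+1%:R](mulrSr 1 n).
have [nz|zn] := leP (n%:R + 1) z.
  have ng : n%:R <= z by lra.
  by rewrite IH3// mulr1n; split=> //; lra.
rewrite mulr0n addr0; split=> // zn1; last by lra.
Qed.

Lemma staircase (R : realType) (y : R) (n : nat) : (0 < n)%N -> 0 <= y <= 1 ->
  n%:R^-1 * \sum_(k < n) (k.+1%:R / n%:R <= y)%R%:R <= y <=
  n%:R^-1 * \sum_(k < n) (k.+1%:R / n%:R <= y)%R%:R + n%:R^-1.
Proof.
move=> n0 /andP[y0 y1]; have nR : 0 < n%:R :> R by rewrite ltr0n.
have -> : \sum_(k < n) (k.+1%:R / n%:R <= y)%R%:R =
    \sum_(k < n) (k.+1%:R <= y * n%:R)%R%:R :> R.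
  by apply: eq_bigr => k _; rewrite ler_pdivrMr.
have [|h1 h2 _] := @staircase_sum R (y * n%:R) n;
  first by rewrite mulr_ge0// ltW.
rewrite mulrC ler_pdivrMr// h1/= -[X in _ + X]mul1r -mulrDl ler_pdivlMr//.
by apply: h2; rewrite ler_piMl// ltW.
Qed.

Section RepresentingContent.
Variables (E : effectAlgebraType) (R : realType) (s : states E R).
Local Notation X := (ptws_space E R).
Local Notation T := (state_space s).
Local Notation V := (bounded_function R T).
Local Notation Xe := (extreme_states s).
Hypothesis cK : compact (states E R).
Implicit Types (f g : V) (l : seq (R * E)).

Let valK (x : T) : states E R (\val x : X). Proof. exact/set_mem/valP. Qed.

Let valD f g x : (f + g) x = f x + g x. Proof. by []. Qed.
Let valZ (t : R) f x : (t *: f) x = t * f x. Proof. by []. Qed.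

Let majorants f : set (seq (R * E)) :=
  [set l | forall x : T, Xe x -> f x <= lincomb l (\val x : X)].

(** The value at [s] of the upper envelope of [f], where majorants need only dominate [f] on the
    extreme states. *)
Let q0 f : R := inf [set lincomb l (\val s : X) | l in majorants f].

(** By Bauer's principle the value of [l] at [s] is at least its value at some extreme state, where
    [l] dominates [f]. *)
Let majorant_ge f l (M : R) : majorants f l ->
  (forall x : T, Xe x -> M <= f x) -> M <= lincomb l (\val s : X).
Proof.
move=> lf Mf.
have K0 : states E R !=set0 by exists (\val s); exact/set_mem/valP.
have [e exte emin] := bauer_minimum cK l K0.
have eK : e \in states E R by apply/mem_set; case: exte.
pose x : T := exist _ e eK.
apply: le_trans (emin _ (set_mem (valP s))).
by apply: le_trans (Mf x exte) (lf x exte).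
Qed.

Let q0_has_inf f : has_inf [set lincomb l (\val s : X) | l in majorants f].
Proof.
have /asboolP[M fM] : (f : T -> R^o) \in @bounded_real_pred R T by exact: valP.
split.
  exists (lincomb [:: (M, pone)] (\val s : X)); exists [:: (M, pone)] => //.
  move=> x _; rewrite /lincomb big_seq1/=;
    have [_ ->] := (statesP _).1 (valK x).
  by rewrite mulr1; apply: le_trans (fM x); exact: ler_norm.
exists (- M) => _ [l lf <-]; apply: majorant_ge lf _ => x _.
by have := fM x; rewrite ler_norml => /andP[].
Qed.

Let q0_le f l : majorants f l -> q0 f <= lincomb l (\val s : X).
Proof. by move=> lf; apply: ge_inf; [exact: (q0_has_inf f).2|exists l]. Qed.

Let scale_list (t : R) l := [seq (t * i.1, i.2) | i <- l].

Let lincomb_scale (t : R) l (p : X) :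
  lincomb (scale_list t l) p = t * lincomb l p.
Proof.
by rewrite /lincomb big_map mulr_sumr; apply: eq_bigr => i _; rewrite mulrA.
Qed.

Let q0_scale_le (t : R) f : 0 < t -> q0 (t *: f) <= t * q0 f.
Proof.
move=> t0; rewrite mulrC -ler_pdivrMr//.
apply: lb_le_inf (q0_has_inf f).1 _ => _ [l lf <-].
rewrite ler_pdivrMr// mulrC -lincomb_scale; apply: q0_le => x Xx.
by rewrite lincomb_scale valZ ler_pM2l//; exact: lf.
Qed.

Let q0_0 : q0 0 = 0.
Proof.
apply/eqP; rewrite eq_le; apply/andP; split.
  have : majorants 0 [::] by move=> x _; rewrite /lincomb big_nil.
  by move=> /q0_le; rewrite /lincomb big_nil.
apply: lb_le_inf (q0_has_inf 0).1 _ => _ [l lf <-].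
by apply: majorant_ge lf _ => x _; exact: lexx.
Qed.

Let q0_sublinear : sublinear q0.
Proof.
split=> [f g|t f].
  apply/ler_addgt0Pr => e e0; have e2 : 0 < e / 2 by rewrite divr_gt0.
  have [_ [l lf <-] le] := inf_adherent e2 (q0_has_inf f).
  have [_ [l' lg <-] l'e] := inf_adherent e2 (q0_has_inf g).
  have : majorants (f + g) (l ++ l').
    by move=> x Xx; rewrite lincomb_cat valD lerD//; [exact: lf|exact: lg].
  by move=> /q0_le; rewrite lincomb_cat -/(q0 f) -/(q0 g); move: le l'e;
    rewrite -/(q0 f) -/(q0 g); lra.
rewrite le_eqVlt => /predU1P[<-|t0]; first by rewrite scale0r q0_0 mul0r.
apply/eqP; rewrite eq_le q0_scale_le//=.
have ti : 0 < t^-1 by rewrite invr_gt0.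
have := q0_scale_le (t *: f) ti; rewrite scalerA mulVf ?gt_eqF// scale1r.
by rewrite -(ler_pM2l t0) mulrA mulfV ?gt_eqF// mul1r.
Qed.

Let ind_bounded (A : set T) : (\1_A : T -> R^o) \in @bounded_real_pred R T.
Proof.
apply/asboolP; exists 1 => x; rewrite indicE.
by case: (_ \in _); rewrite ?normr1 ?normr0.
Qed.

Let ind (A : set T) : V := BoundedFunction (ind_bounded A).

(** The content of a set is the Hahn-Banach functional [F] at its indicator. Each property of [m]
    other than additivity follows by exhibiting a combination of evaluations that majorizes a
    suitable function. *)
Lemma representing_content : exists m : set T -> R,
  [/\ finitely_additive_probability m, m Xe = 1 &
    forall a n, (0 < n)%N -> (\val s : X) a <=
      n%:R^-1 * (\sum_(k < n)
        m [set x | Xe x /\ k.+1%:R / n%:R <= (\val x : X) a]) + n%:R^-1].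
Proof.
have [F [FD FZ Fle]] := hahn_banach q0_sublinear.
have F0 : F 0 = 0 by have := FD 0 0; rewrite addr0 => ?; lra.
have FN f : F (- f) = - F f.
  by have := FD f (- f); rewrite subrr F0 => ?; lra.
have Fmaj f l : majorants f l -> F f <= lincomb l (\val s : X).
  by move=> lf; exact: le_trans (Fle f) (q0_le lf).
have lin1 (c : R) (x : T) : lincomb [:: (c, pone)] (\val x : X) = c.
  rewrite /lincomb big_seq1/=; have [_ ->] := (statesP _).1 (valK x).
  by rewrite mulr1.
have F_le1 A : F (ind A) <= 1.
  rewrite -(lin1 1 s); apply: Fmaj => x _; rewrite lin1 /= indicE.
  by case: (_ \in _).
have F_eq1 A : Xe `<=` A -> F (ind A) = 1.
  move=> XA; apply/eqP; rewrite eq_le F_le1/=.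
  have : F (- ind A) <= - 1.
    rewrite -(lin1 (- 1) s); apply: Fmaj => x /XA Ax; rewrite lin1.
    have -> : (- ind A) x = - \1_A x by [].
    by rewrite indicE mem_set.
  by rewrite FN lerN2.
exists (fun A => F (ind A)); split; last 1 first.
- move=> a n n0; have nR : 0 < n%:R :> R by rewrite ltr0n.
  pose A k : set T := [set x | Xe x /\ k.+1%:R / n%:R <= (\val x : X) a].
  (* By [staircase], [g] dominates the evaluation at [a] on the extreme states; hence [- g] is
     majorized by minus that evaluation. *)
  pose g : V := n%:R^-1 *: (\sum_(k < n) ind (A k)) + n%:R^-1 *: ind Xe.
  have FS (m : nat) : F (\sum_(k < m) ind (A k)) = \sum_(k < m) F (ind (A k)).
    elim: m => [|m IH]; first by rewrite !big_ord0.
    by rewrite !big_ord_recr/= FD IH.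
  have VS (m : nat) x : (\sum_(k < m) ind (A k) : V) x =
      \sum_(k < m) (\1_(A k) x : R).
    elim: m => [|m IH]; first by rewrite !big_ord0.
    by rewrite !big_ord_recr valD IH.
  have : F (- g) <= - (\val s : X) a.
    have lE (x : T) : lincomb [:: (- 1, a)] (\val x : X) = - (\val x : X) a.
      by rewrite /lincomb big_seq1/= mulN1r.
    rewrite -lE; apply: Fmaj => x Xx; rewrite lE.
    have -> : (- g) x = - g x by [].
    rewrite lerN2 /g valD !valZ VS /= indicE mem_set// mulr1.
    have := @staircase R ((\val x : X) a) n n0.
    have [/(_ a) xa _ _] := valK x; move=> /(_ xa)/andP[_].
    move=> /le_trans; apply; rewrite lerD2r ler_pM2l ?invr_gt0//.
    apply: ler_sum => k _; rewrite indicE.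
    have [h|_] := leP (k.+1%:R / n%:R) ((\val x : X) a); last by rewrite ler0n.
    by rewrite mem_set.
  rewrite FN lerN2 /g FD !FZ ?invr_ge0 ?(ltW nR)// FS F_eq1// mulr1.
  by [].
- split; last exact: F_eq1.
  + move=> A; rewrite -oppr_le0 -FN.
    have lE (x : T) : lincomb [::] (\val x : X) = 0 by rewrite /lincomb big_nil.
    rewrite -(lE s); apply: Fmaj => x _; rewrite lE.
    have -> : (- ind A) x = - \1_A x by [].
    by rewrite oppr_le0 indicE; case: (_ \in _).
  + move=> A B AB; rewrite -FD; congr F; apply: val_inj; apply/funext => x.
    have -> : \val (ind A + ind B) x = \1_A x + \1_B x by [].
    rewrite /= !indicE in_setU.
    have [xA|] := boolP (x \in A); have [xB|] := boolP (x \in B);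
      rewrite ?addr0 ?add0r//.
    have : (A `&` B) x by split; exact: set_mem.
    by rewrite AB.
- exact: F_eq1.
Qed.

End RepresentingContent.

Section Existence.
Variables (E : effectAlgebraType) (R : realType) (s : states E R).
Local Notation X := (ptws_space E R).
Local Notation T := (state_space s).
Local Notation Xe := (extreme_states s : set (borel T)).
Hypothesis cK : compact (states E R).
Hypothesis cX : compact (extreme_points (states E R)).

Let clX : closed (extreme_states s) := @extreme_states_closed E R s cX.
Let mX : measurable Xe. Proof. exact: closed_borel. Qed.

Let Rintegral_sum_indic (mu : probability (borel T) R)
    (A : nat -> set (borel T)) n :
  (forall k, measurable (A k)) -> (forall k, A k `<=` Xe) ->
  mu.-integrable Xe (EFin \o (fun x => \sum_(k < n) (\1_(A k) x : R))) /\
  \int[mu]_(x in Xe) \sum_(k < n) (\1_(A k) x : R) = \sum_(k < n) fine (mu (A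
    k)).
Proof.
move=> mA AX; elim: n => [|n [IH1 IH2]].
  rewrite (_ : (fun _ => _) = fun=> 0); last first.
    by apply/funext => x; rewrite big_ord0.
  split; last by rewrite big_ord0 Rintegral_cst// mul0r.
  exact: integrable0.
have indI : mu.-integrable Xe (EFin \o (\1_(A n) : borel T -> R)).
  apply: measurable_bounded_integrable => //.
  - by rewrite (le_lt_trans (probability_le1 mu mX))// ltry.
  - exists 1; split=> // M M1 x _ /=; apply: le_trans (ltW M1).
    by rewrite indicE; case: (_ \in _); rewrite ?normr1 ?normr0.
have sumE : (fun x => \sum_(k < n.+1) (\1_(A k) x : R)) =
    fun x => \sum_(k < n) (\1_(A k) x : R) + \1_(A n) x.
  by apply/funext => x; rewrite big_ord_recr.
split; first by rewrite sumE; exact: (integrableD mX IH1 indI).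
rewrite sumE RintegralD// IH2 big_ord_recr; congr (_ + _).
by rewrite /Rintegral integral_indic// setIidl.
Qed.

(** The level sets in the staircase estimate are closed, so [mu] dominates [m] on them, and [n]
    tending to infinity shows that the barycenter of [mu] dominates [s] at every [a]. *)
Lemma representing_measure : exists mu : probability (borel T) R,
  regular_measure mu /\ represents mu.
Proof.
have [m [m_prob mX1 ms]] := representing_content s cK.
have [mu [reg mu_ge]] := finitely_additive_regular_measure
  (@state_space_hausdorff E R s) (state_space_compact cK) m_prob.
exists mu; split=> //.
have fin_ge C : closed C -> m C <= fine (mu C).
  move=> cC; have mC := closed_borel cC.
  by have := mu_ge C cC; rewrite -(fineK (fin_num_measure mu _ mC)) lee_fin.
have le_mean a : (\val s : X) a <= mean mu Xe a.
  apply/ler_addgt0Pr => e e0; pose n := (Num.bound e^-1).+1.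
  have nR : 0 < n%:R :> R by rewrite ltr0n.
  have ne : n%:R^-1 <= e.
    rewrite -[leRHS]invrK lef_pV2 ?posrE ?invr_gt0// /n -natr1.
    have := archi_boundP (ltW (etrans (invr_gt0 e) e0)); lra.
  pose A (k : nat) : set (borel T) :=
    [set x | Xe x /\ k.+1%:R / n%:R <= (\val x : X) a].
  have clA k : closed (A k : set T).
    have cl : closed ((fun x : T => (\val x : X) a : R^o) @^-1`
        [set r : R^o | k.+1%:R / n%:R <= r]).
      apply: closed_comp; last exact: closed_ge.
      by move=> x _; exact: eval_state_continuous.
    exact: closedI clX cl.
  have [//||sumI sumE] := @Rintegral_sum_indic mu A n.
  - by move=> k; exact: closed_borel.
  - by move=> k x [].
  have : n%:R^-1 * (\sum_(k < n) m (A k)) <= mean mu Xe a.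
    apply: (@le_trans _ _ (n%:R^-1 * \sum_(k < n) fine (mu (A k)))).
      by rewrite ler_pM2l ?invr_gt0//; apply: ler_sum => k _; exact: fin_ge.
    rewrite -sumE -RintegralZl//; apply: le_Rintegral => //.
    - have := integrableZl mX n%:R^-1 sumI.
      by apply: eq_integrable => // x _; rewrite /= EFinM.
    - exact: eval_integrable.
    move=> x Xx; have [/(_ a) xa _ _] : states E R (\val x : X).
      exact/set_mem/valP.
    have /andP[h _] := @staircase R ((\val x : X) a) n isT xa.
    apply: le_trans h; rewrite ler_pM2l ?invr_gt0//; apply: ler_sum => k _.
    rewrite indicE; have [xA|//] := boolP (x \in A k).
    by have [_ ->] := set_mem xA.
  have := ms a n isT; rewrite -/(A _) => h1 h2.
  by apply: le_trans h1 _; apply: lerD.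
have mC := mean_state_cone cK mu mX.
have [sC s1] := (statesP (\val s)).1 (set_mem (valP s)).
have mean1 : mean mu Xe pone <= 1.
  rewrite mean_pone//.
  have := probability_le1 mu mX; rewrite -(fineK (fin_num_measure mu _ mX)).
  by rewrite lee_fin.
move=> a; rewrite /evaluation.
have -> : (\int[mu]_(x in extreme_states s) ((\val x : X) a)%:E)%E =
    (mean mu Xe a)%:E.
  rewrite /mean /Rintegral fineK//.
  by apply: integrable_fin_num => //; exact: (eval_integrable cK mu a mX).
congr (_%:E); apply/eqP; rewrite eq_le le_mean/=.
(* Domination holds at [a] and at [a'], while the values at both add up to 1 for [s] and to at most
   1 for the mean; so equality holds. *)
have [a' [aa' _]] := orthosupplement a.
have meanD := mC.2 _ _ _ aa'; have sD := sC.2 _ _ _ aa'.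
change (mean mu Xe a <= (\val s : X) a).
rewrite s1 in sD; move: mean1 meanD sD (le_mean a'); lra.
Qed.

End Existence.

Theorem theorem6p5 (R : realType) (E : effectAlgebraType)
    (E_interval : interval_effect_algebra E)
    (E_BSP : Bauer_simplex (states E R))
    (s : states E R) :
  exists mu : probability (borel (state_space s)) R,
    [/\ regular_measure mu, represents mu &
      forall nu : probability (borel (state_space s)) R,
        regular_measure nu -> represents nu ->
        forall Y : set (borel (state_space s)), measurable Y -> nu Y = mu Y].
Proof.
have [smpK cK cX] := E_BSP.
have [mu [reg rep]] := representing_measure s cK cX.
exists mu; split=> // nu regnu repnu; apply: represents_unique => //.
exact: simplex_riesz.
Qed.
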